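(* Let $z^+(u)$ and $z^-(u)$ be the series in $u$ and $u^{-1}$, respectively, with coefficients in $\mathrm{U}_q(\widehat{\mathfrak{gl}}_n)$ determined by $$L^{\pm}(uq^{2n})^tD(L^{\pm}(u)^{-1})^t=z^{\pm}(u)D .$$ Then $$z^{\pm}(u)=\frac{\mathrm{qdet}\,L^{\pm}(uq^{2})}{\mathrm{qdet}\,L^{\pm}(u)}.$$
   Context: Throughout, $q$ is a nonzero complex number which is not a root of unity. Let $e_{ij}\in\mathrm{End}\,\mathbb{C}^n$ be the standard matrix units. Put $$R=q\sum_{i}e_{ii}\otimes e_{ii}+\sum_{i\ne j}e_{ii}\otimes e_{jj}+(q-q^{-1})\sum_{i<j}e_{ij}\otimes e_{ji},$$ $$\widetilde R=q^{-1}\sum_{i}e_{ii}\otimes e_{ii}+\sum_{i\ne j}e_{ii}\otimes e_{jj}-(q-q^{-1})\sum_{i>j}e_{ij}\otimes e_{ji},$$ $$R(x)=\frac{f(x)}{q-q^{-1}x}\,(R-x\widetilde R),$$ where $f(x)=1+\sum_{k\geqslant1}f_kx^k$ is the unique formal power series with complex coefficients satisfying $f(xq^{2n})=f(x)\dfrac{(1-xq^2)(1-xq^{2n-2})}{(1-x)(1-xq^{2n})}$. The quantum affine algebra $\mathrm{U}_q(\widehat{\mathfrak{gl}}_n)$ is the unital associative algebra over $\mathbb{C}$ generated by elements $l^+_{ij}[-r]$, $l^-_{ij}[r]$ with $1\leqslant i,j\leqslant n$, $r=0,1,\dots$, and an invertible central element $q^c$, subject to the defining relations $l^+_{ji}[0]=l^-_{ij}[0]=0$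 for $1\leqslant i<j\leqslant n$; $\ l^+_{ii}[0]l^-_{ii}[0]=l^-_{ii}[0]l^+_{ii}[0]=1$ for $i=1,\dots,n$; and $$R(u/v)L_1^{\pm}(u)L_2^{\pm}(v)=L_2^{\pm}(v)L_1^{\pm}(u)R(u/v),$$ $$R(uq^{-c}/v)L_1^{+}(u)L_2^{-}(v)=L_2^{-}(v)L_1^{+}(u)R(uq^{c}/v),$$ where $l^{+}_{ij}(u)=\sum_{r\geqslant0}l^{+}_{ij}[-r]u^r$, $l^{-}_{ij}(u)=\sum_{r\geqslant0}l^{-}_{ij}[r]u^{-r}$, and $L^{\pm}(u)=[l^{\pm}_{ij}(u)]=\sum_{i,j}e_{ij}\otimes l^{\pm}_{ij}(u)$. Subscripts $1,2$ indicate the copy of $\mathrm{End}\,\mathbb{C}^n$ in which the matrix part lies. In the first relation the common scalar factor of $R(u/v)$ may be cancelled on both sides, so it is equivalent to the same relation with $R(u/v)$ replaced by $vR-u\widetilde R$. The matrices $L^{\pm}(u)$ are invertible since their constant terms are triangular with invertible diagonal entries. The superscript $t$ denotes the usual matrix transposition (transposing the positions of entries, without changing the entries in the algebra), and $D=\mathrm{diag}[q^{n-1},q^{n-3},\dots,q^{-n+1}]$. There exist (unique) series $z^{\pm}(u)$ as in the claim. The quantum determinants are the series in $u^{\pm1}$ defined by $$\mathrm{qdet}\,L^{\pm}(u)=\sum_{\sigma\in\mathfrak{S}_n}(-q)^{-l(\sigma)}\,l^{\pm}_{\sigma(1)1}(uq^{2n-2})\,l^{\pm}_{\sigma(2)2}(uq^{2n-4})\cdots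 l^{\pm}_{\sigma(n)n}(u),$$ where $l(\sigma)$ is the length of the permutation $\sigma$. Their coefficients belong to the center of $\mathrm{U}_q(\widehat{\mathfrak{gl}}_n)$ and their constant terms are invertible, so the quotient in the claim is unambiguous. *)

(* Defs.v *)
From HB Require Import structures.
From mathcomp Require Import all_boot all_order all_algebra perm generic_quotient.
From mathcomp Require Import boolp reals.
From mathcomp Require Import complex mxtens.
From mathcomp Require Import finmap monalg.

Set Implicit Arguments.
Unset Strict Implicit.
Unset Printing Implicit Defensive.

Import GRing.Theory.
Local Open Scope ring_scope.
Local Open Scope quotient_scope.

(******************************************************************************)
(* Formal power series over a possibly noncommutative ring, with the Cauchy   *)
(* product.                                                                   *)
(******************************************************************************)
Record fps (A : Type) := Fps { fps_coef :> nat -> A }.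

Section FpsType.
Variable A : Type.

Lemma fpsP (s t : fps A) : (forall k, s k = t k) -> s = t.
Proof. by case: s t => [s] [t] /= st; congr Fps; apply: funext. Qed.

HB.instance Definition _ := gen_eqMixin (fps A).
HB.instance Definition _ := gen_choiceMixin (fps A).

End FpsType.

Section FpsRing.
Variable A : nzRingType.
Implicit Types s t u : fps A.

Definition fps0 : fps A := Fps (fun=> 0).
Definition fps_opp s := Fps (fun k => - s k).
Definition fps_add s t := Fps (fun k => s k + t k).
Definition fps_const (c : A) := Fps (fun k => if k == 0%N then c else 0).
Definition fps_mul s t := Fps (fun k => \sum_(i < k.+1) s i * t (k - i)%N).

Lemma fps_addA : associative fps_add.
Proof. by move=> s t u; apply: fpsP => k /=; rewrite addrA. Qed.
Lemma fps_addC : commutative fps_add.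
Proof. by move=> s t; apply: fpsP => k /=; rewrite addrC. Qed.
Lemma fps_add0 : left_id fps0 fps_add.
Proof. by move=> s; apply: fpsP => k /=; rewrite add0r. Qed.
Lemma fps_addN : left_inverse fps0 fps_opp fps_add.
Proof. by move=> s; apply: fpsP => k /=; rewrite addNr. Qed.

HB.instance Definition _ :=
  GRing.isZmodule.Build (fps A) fps_addA fps_addC fps_add0 fps_addN.

Let trunc m s : {poly A} := \poly_(i < m) s i.

Let mulE s t k m p : (k < m)%N -> (k < p)%N ->
  fps_mul s t k = (trunc m s * trunc p t)`_k.
Proof.
move=> km kp; rewrite coefM /=; apply: eq_bigr => i _; rewrite !coef_poly.
have ik : (i <= k)%N by rewrite -ltnS.
by rewrite (leq_ltn_trans ik km) (leq_ltn_trans (leq_subr _ _) kp).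
Qed.

Lemma fps_mulA : associative fps_mul.
Proof.
move=> s t u; apply: fpsP => k.
transitivity ((trunc k.+1 s * (trunc k.+1 t * trunc k.+1 u))`_k).
  rewrite coefM /=; apply: eq_bigr => i _.
  have ik : (i < k.+1)%N by [].
  rewrite coef_poly ik; congr (_ * _).
  by rewrite -(@mulE t u) // ltnS leq_subr.
rewrite mulrA coefM /=; apply: eq_bigr => i _.
rewrite [X in _ * X]coef_poly ltnS leq_subr; congr (_ * _).
by rewrite -(@mulE s t).
Qed.

Lemma fps_mul1l : left_id (fps_const 1) fps_mul.
Proof.
move=> s; apply: fpsP => k /=; rewrite big_ord_recl /= subn0 mul1r.
by rewrite big1 ?addr0 // => i _; rewrite mul0r.
Qed.

Lemma fps_mul1r : right_id (fps_const 1) fps_mul.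
Proof.
move=> s; apply: fpsP => k /=; rewrite big_ord_recr /= subnn mulr1.
rewrite big1 ?add0r // => i _.
by rewrite (negbTE (_ : (k - i)%N != 0%N)) ?mulr0 // subn_eq0 -ltnNge.
Qed.

Lemma fps_mulDl : left_distributive fps_mul fps_add.
Proof.
move=> s t u; apply: fpsP => k /=; rewrite -big_split.
by apply: eq_bigr => i _ /=; rewrite mulrDl.
Qed.

Lemma fps_mulDr : right_distributive fps_mul fps_add.
Proof.
move=> s t u; apply: fpsP => k /=; rewrite -big_split.
by apply: eq_bigr => i _ /=; rewrite mulrDr.
Qed.

Lemma fps_1neq0 : fps_const 1 != 0.
Proof.
by apply/eqP => /(congr1 (fun s : fps A => s 0%N)) /= /eqP; rewrite oner_eq0.
Qed.

HB.instance Definition _ := GRing.Zmodule_isNzRing.Build (fps A)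
  fps_mulA fps_mul1l fps_mul1r fps_mulDl fps_mulDr fps_1neq0.

Definition fpsX : fps A := Fps (fun k => (k == 1%N)%:R).

(* Inverses are chosen classically, so that t / s is the usual quotient when  *)
(* s has a two-sided inverse (and s^-1 = s otherwise).                        *)
Definition fps_unit : pred (fps A) :=
  fun s => `[< exists t, t * s = 1 /\ s * t = 1 >].

Definition fps_inv s : fps A :=
  if pselect (exists t, t * s = 1 /\ s * t = 1) is left e
  then projT1 (cid e) else s.

Lemma fps_mulV : {in fps_unit, left_inverse 1 fps_inv *%R}.
Proof.
move=> s /asboolP us; rewrite /fps_inv.
by case: pselect => // e; case: (cid e) => t [].
Qed.

Lemma fps_divV : {in fps_unit, right_inverse 1 fps_inv *%R}.
Proof.
move=> s /asboolP us; rewrite /fps_inv.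
by case: pselect => // e; case: (cid e) => t [].
Qed.

Lemma fps_unitP s t : t * s = 1 /\ s * t = 1 -> fps_unit s.
Proof. by move=> ts; apply/asboolP; exists t. Qed.

Lemma fps_inv_out : {in [predC fps_unit], fps_inv =1 id}.
Proof.
move=> s; rewrite inE => /asboolP us.
by rewrite /fps_inv; case: pselect.
Qed.

HB.instance Definition _ := GRing.NzRing_hasMulInverse.Build (fps A)
  fps_mulV fps_divV fps_unitP fps_inv_out.

End FpsRing.

Arguments fpsX {A}.

(* s(x) |-> s(c x) *)
Definition fps_dil (C : nzRingType) (A : lalgType C) (c : C) (s : fps A)
  : fps A := Fps (fun k => c ^+ k *: s k).

(* The two-sided inverse of a square matrix over any ring (M itself if there  *)
(* is none); the library's invmx requires a commutative ring.                 *)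
Definition mxinv (A : pzRingType) n (M : 'M[A]_n) : 'M[A]_n :=
  if pselect (exists N, N *m M = 1%:M /\ M *m N = 1%:M) is left e
  then projT1 (cid e) else M.

(******************************************************************************)
(* Quotient of an algebra by a proper two-sided ideal.                        *)
(******************************************************************************)
Record tsideal (C : comNzRingType) (F : algType C) := TSIdeal {
  tsideal_pred :> F -> Prop;
  tsideal0 : tsideal_pred 0;
  tsidealB : forall x y, tsideal_pred x -> tsideal_pred y ->
    tsideal_pred (x - y);
  tsidealMl : forall x y, tsideal_pred y -> tsideal_pred (x * y);
  tsidealMr : forall x y, tsideal_pred x -> tsideal_pred (x * y);
  tsideal1 : ~ tsideal_pred 1 }.

Section QuotientAlgebra.
Variables (C : comNzRingType) (F : algType C) (I : tsideal F).

Definition ideal_equiv : rel F := fun x y => `[< I (x - y) >].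

Let idealN x : I x -> I (- x).
Proof. by move=> Ix; rewrite -sub0r; apply: tsidealB => //; apply: tsideal0. Qed.

Let idealD x y : I x -> I y -> I (x + y).
Proof. by move=> Ix Iy; rewrite -[y]opprK; apply/tsidealB/idealN. Qed.

Lemma ideal_equiv_refl : reflexive ideal_equiv.
Proof. by move=> x; apply/asboolP; rewrite subrr; apply: tsideal0. Qed.

Lemma ideal_equiv_sym : symmetric ideal_equiv.
Proof.
by move=> x y; apply/asboolP/asboolP => /idealN; rewrite opprB.
Qed.

Lemma ideal_equiv_trans : transitive ideal_equiv.
Proof.
move=> y x z /asboolP xy /asboolP yz; apply/asboolP.
by rewrite -(subrKA y); apply: idealD.
Qed.

Canonical ideal_equiv_rel :=
  EquivRel ideal_equiv ideal_equiv_refl ideal_equiv_sym ideal_equiv_trans.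

Definition quotalg := {eq_quot ideal_equiv}.

HB.instance Definition _ := Quotient.on quotalg.
HB.instance Definition _ := Choice.on quotalg.

Definition quot_pi (x : F) : quotalg := \pi x.

Lemma quot_piP x y : quot_pi x = quot_pi y <-> I (x - y).
Proof.
split=> [xy|Ixy].
  by apply/asboolP; rewrite -[asbool _]/(ideal_equiv x y) -eqmodE; apply/eqP.
by apply/eqP; rewrite eqmodE; apply/asboolP.
Qed.

Lemma quot_piK (x : quotalg) : quot_pi (repr x) = x.
Proof. exact: reprK. Qed.

Let repr_piB x : I (repr (quot_pi x) - x).
Proof. by apply/quot_piP; rewrite quot_piK. Qed.

Definition quot_opp (x : quotalg) := quot_pi (- repr x).
Definition quot_add (x y : quotalg) := quot_pi (repr x + repr y).
Definition quot_mul (x y : quotalg) := quot_pi (repr x * repr y).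
Definition quot_scale (c : C) (x : quotalg) := quot_pi (c *: repr x).

Let piN x : quot_opp (quot_pi x) = quot_pi (- x).
Proof. by apply/quot_piP; rewrite -opprD; apply: idealN. Qed.

Let piD x y : quot_add (quot_pi x) (quot_pi y) = quot_pi (x + y).
Proof. by apply/quot_piP; rewrite opprD addrACA; apply: idealD. Qed.

Let piM x y : quot_mul (quot_pi x) (quot_pi y) = quot_pi (x * y).
Proof.
apply/quot_piP; rewrite -(subrKA (x * repr (quot_pi y))) -mulrBl -mulrBr.
by apply: idealD; [apply: tsidealMr | apply: tsidealMl].
Qed.

Let piZ c x : quot_scale c (quot_pi x) = quot_pi (c *: x).
Proof.
apply/quot_piP; rewrite -scalerBr -[_ - x]mul1r scalerAl.
exact: tsidealMl.
Qed.

Let piE := (piN, piD, piM, piZ).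

Lemma quot_addA : associative quot_add.
Proof.
by move=> x y z; rewrite -[x]quot_piK -[y]quot_piK -[z]quot_piK !piE addrA.
Qed.
Lemma quot_addC : commutative quot_add.
Proof. by move=> x y; rewrite -[x]quot_piK -[y]quot_piK !piE addrC. Qed.
Lemma quot_add0 : left_id (quot_pi 0) quot_add.
Proof. by move=> x; rewrite -[x]quot_piK !piE add0r. Qed.
Lemma quot_addN : left_inverse (quot_pi 0) quot_opp quot_add.
Proof. by move=> x; rewrite -[x]quot_piK !piE addNr. Qed.

HB.instance Definition _ :=
  GRing.isZmodule.Build quotalg quot_addA quot_addC quot_add0 quot_addN.

Lemma quot_mulA : associative quot_mul.
Proof.
by move=> x y z; rewrite -[x]quot_piK -[y]quot_piK -[z]quot_piK !piE mulrA.
Qed.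
Lemma quot_mul1l : left_id (quot_pi 1) quot_mul.
Proof. by move=> x; rewrite -[x]quot_piK !piE mul1r. Qed.
Lemma quot_mul1r : right_id (quot_pi 1) quot_mul.
Proof. by move=> x; rewrite -[x]quot_piK !piE mulr1. Qed.
Lemma quot_mulDl : left_distributive quot_mul quot_add.
Proof.
by move=> x y z; rewrite -[x]quot_piK -[y]quot_piK -[z]quot_piK !piE mulrDl.
Qed.
Lemma quot_mulDr : right_distributive quot_mul quot_add.
Proof.
by move=> x y z; rewrite -[x]quot_piK -[y]quot_piK -[z]quot_piK !piE mulrDr.
Qed.
Lemma quot_1neq0 : quot_pi 1 != 0.
Proof. by apply/eqP => /quot_piP; rewrite subr0; apply: tsideal1. Qed.

HB.instance Definition _ := GRing.Zmodule_isNzRing.Build quotalg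
  quot_mulA quot_mul1l quot_mul1r quot_mulDl quot_mulDr quot_1neq0.

Lemma quot_scaleA a b x :
  quot_scale a (quot_scale b x) = quot_scale (a * b) x.
Proof. by rewrite -[x]quot_piK !piE scalerA. Qed.
Lemma quot_scale1 : left_id 1 quot_scale.
Proof. by move=> x; rewrite -[x]quot_piK !piE scale1r. Qed.
Lemma quot_scaleDr : right_distributive quot_scale quot_add.
Proof.
by move=> a x y; rewrite -[x]quot_piK -[y]quot_piK !piE scalerDr.
Qed.
Lemma quot_scaleDl x :
  {morph quot_scale^~ x : a b / a + b >-> quot_add a b}.
Proof. by move=> a b; rewrite -[x]quot_piK !piE scalerDl. Qed.

HB.instance Definition _ := GRing.Zmodule_isLmodule.Build C quotalg
  quot_scaleA quot_scale1 quot_scaleDr quot_scaleDl.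

Lemma quot_scaleAl a x y :
  quot_scale a (quot_mul x y) = quot_mul (quot_scale a x) y.
Proof. by rewrite -[x]quot_piK -[y]quot_piK !piE scalerAl. Qed.
Lemma quot_scaleAr a x y :
  quot_scale a (quot_mul x y) = quot_mul x (quot_scale a y).
Proof. by rewrite -[x]quot_piK -[y]quot_piK !piE scalerAr. Qed.

HB.instance Definition _ :=
  GRing.Lmodule_isLalgebra.Build C quotalg quot_scaleAl.

HB.instance Definition _ :=
  GRing.Lalgebra_isAlgebra.Build C quotalg quot_scaleAr.

Lemma quot_pi_zmod_morphism : zmod_morphism quot_pi.
Proof. by move=> x y; rewrite -piD -piN. Qed.
Lemma quot_pi_monoid_morphism : monoid_morphism quot_pi.
Proof. by split=> // x y; rewrite -piM. Qed.
Lemma quot_pi_scalable : scalable quot_pi.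
Proof. by move=> c x; rewrite -piZ. Qed.

HB.instance Definition _ :=
  GRing.isZmodMorphism.Build F quotalg quot_pi quot_pi_zmod_morphism.
HB.instance Definition _ :=
  GRing.isMonoidMorphism.Build F quotalg quot_pi quot_pi_monoid_morphism.
HB.instance Definition _ :=
  GRing.isScalable.Build C F quotalg *:%R quot_pi quot_pi_scalable.

End QuotientAlgebra.

(* The two-sided ideal generated by S, as the intersection of all two-sided   *)
(* ideals containing S.                                                       *)
Section GeneratedIdeal.
Variables (C : comNzRingType) (F : algType C).

Definition ideal_closed (J : F -> Prop) :=
  [/\ J 0, forall x y, J x -> J y -> J (x - y),
      forall x y, J y -> J (x * y) & forall x y, J x -> J (x * y)].

Variables (S : F -> Prop).

Definition ideal_gen (x : F) :=
  forall J, ideal_closed J -> (forall y, S y -> J y) -> J x.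

Lemma ideal_gen_closed : ideal_closed ideal_gen.
Proof.
split=> [J []|x y gx gy J cJ SJ|x y gy J cJ SJ|x y gx J cJ SJ] //.
- by case: (cJ) => _ + _ _; apply; [apply: gx | apply: gy].
- by case: (cJ) => _ _ + _; apply; apply: gy.
- by case: (cJ) => _ _ _; apply; apply: gx.
Qed.

Definition tsideal_gen (S_proper : ~ ideal_gen 1) : tsideal F :=
  let: And4 J0 JB JMl JMr := ideal_gen_closed in
  TSIdeal J0 JB JMl JMr S_proper.

End GeneratedIdeal.

(* The free C-algebra on a set of generators. A new name is needed for the    *)
(* algType structure: {malg C[M]} has one only for commutative monoids M.     *)
Definition freealg (C : comNzRingType) (T : choiceType) :=
  {malg C[{fmonom T}]}.

Section FreeAlgebra.
Variables (C : comNzRingType) (T : choiceType).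

HB.instance Definition _ := GRing.Lalgebra.on (freealg C T).

Let malg_scaleAr (c : C) (x y : {malg C[{fmonom T}]}) :
  c *: (x * y) = x * (c *: y).
Proof.
apply/malgP => k; rewrite [RHS](mcoeffMlw k (fsubset_refl _) (msuppZ_le c y)).
rewrite (mcoeffZ c (x * y)) [X in c * X](mcoeffMl x y k) mulr_sumr.
apply: eq_bigr => i _; rewrite mulr_sumr; apply: eq_bigr => j _.
by rewrite mcoeffZ mulrCA mulrnAr.
Qed.

Lemma freealg_scaleAr (c : C) (x y : freealg C T) :
  c *: (x * y) = x * (c *: y).
Proof. exact: malg_scaleAr. Qed.

HB.instance Definition _ :=
  GRing.Lalgebra_isAlgebra.Build C (freealg C T) freealg_scaleAr.

Definition fvar (g : T) : freealg C T := << fmu g >>.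

End FreeAlgebra.

(******************************************************************************)
(* The R-matrices. Matrix indices run over 0, ..., n-1, and                   *)
(* End C^n (x) End C^n is 'M_(n * n) through the Kronecker product *t.        *)
(******************************************************************************)
Section RMatrix.
Variables (C : fieldType) (n : nat) (q : C).

Definition Rmat : 'M[C]_(n * n) :=
  q *: (\sum_(i < n) delta_mx i i *t delta_mx i i)
  + \sum_(i < n) \sum_(j < n | i != j) delta_mx i i *t delta_mx j j
  + (q - q^-1) *:
      \sum_(i < n) \sum_(j < n | (i < j)%N) delta_mx i j *t delta_mx j i.

Definition Rtmat : 'M[C]_(n * n) :=
  q^-1 *: (\sum_(i < n) delta_mx i i *t delta_mx i i)
  + \sum_(i < n) \sum_(j < n | i != j) delta_mx i i *t delta_mx j j
  - (q - q^-1) *: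
      \sum_(i < n) \sum_(j < n | (j < i)%N) delta_mx i j *t delta_mx j i.

Local Notation "c %:S" := (fps_const c) (at level 1, format "c %:S").
Local Notation x := (@fpsX C).

(* C^o is C as an algebra over itself. *)
Definition is_Rfactor (f : fps C) : Prop :=
  f 0%N = 1 /\
  fps_dil (q ^+ (2 * n)) (f : fps C^o) =
    f * ((1 - (q ^+ 2)%:S * x) * (1 - (q ^ ((2 * n)%:Z - 2))%:S * x)
         / ((1 - x) * (1 - (q ^+ (2 * n))%:S * x))).

(* R(x), as a matrix of formal power series in x *)
Definition Rser (f : fps C) : 'M[fps C]_(n * n) :=
  (f / (q%:S - (q^-1)%:S * x)) *:
    (map_mx (@fps_const C) Rmat - x *: map_mx (@fps_const C) Rtmat).

Definition Rcoef (f : fps C) (k : nat) : 'M[C]_(n * n) :=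
  map_mx (fun s : fps C => s k) (Rser f).

End RMatrix.

(******************************************************************************)
(* The quantum affine algebra.                                                *)
(******************************************************************************)
Variant sgn := Plus | Minus.

Section Generators.
Variable n : nat.

(* GenL Plus i j r is l^+_ij[-r], GenL Minus i j r is l^-_ij[r], GenQc is q^c *)
(* and GenQcV its inverse.                                                   *)
Variant gen := GenL of sgn & 'I_n & 'I_n & nat | GenQc | GenQcV.

Definition gen_code (g : gen) : (bool * 'I_n * 'I_n * nat) + bool :=
  match g with
  | GenL s i j r => inl ((if s is Plus then true else false), i, j, r)
  | GenQc => inr true
  | GenQcV => inr false
  end.

Definition gen_decode (c : (bool * 'I_n * 'I_n * nat) + bool) : gen :=
  match c with
  | inl (s, i, j, r) => GenL (if s then Plus else Minus) i j r
  | inr b => if b then GenQc else GenQcV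
  end.

Lemma gen_codeK : cancel gen_code gen_decode.
Proof. by case=> [[]||]. Qed.

HB.instance Definition _ := Equality.copy gen (can_type gen_codeK).
HB.instance Definition _ := Choice.copy gen (can_type gen_codeK).

End Generators.

Section Relations.
Variables (C : fieldType) (n : nat) (q : C) (f : fps C).

Local Notation free_gen := (freealg C (gen n)).
Local Notation gvar := (@fvar C (gen n)).

(* The coefficient of u^a in L^+(u) or L^-(u), for any integer a. *)
Definition Lcoef (s : sgn) (a : int) : 'M[free_gen]_n :=
  \matrix_(i, j)
    match s, a with
    | Plus, Posz r => gvar (GenL Plus i j r)
    | Plus, Negz _ => 0
    | Minus, Posz 0 => gvar (GenL Minus i j 0)
    | Minus, Posz r.+1 => 0
    | Minus, Negz r => gvar (GenL Minus i j r.+1)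
    end.

Let one1 (X : 'M[free_gen]_n) : 'M[free_gen]_(n * n) := X *t 1%:M.
Let one2 (X : 'M[free_gen]_n) : 'M[free_gen]_(n * n) := 1%:M *t X.
Let Rk (k : nat) : 'M[free_gen]_(n * n) :=
  map_mx (fun c : C => c%:A) (Rcoef n q f k).

(* The coefficient of u^a v^b in                                              *)
(*   R(u g / v) L1^s(u) L2^s'(v) - L2^s'(v) L1^s(u) R(u g' / v).              *)
(* For (s, s') other than (Minus, Plus) the terms with k > |a| + |b| vanish.  *)
Definition RLLrel (s s' : sgn) (g g' : free_gen) (a b : int)
  : 'M[free_gen]_(n * n) :=
  \sum_(k < (`|a| + `|b|).+1)
    ((g ^+ k *: Rk k) *m one1 (Lcoef s (a - k%:Z)) *m one2 (Lcoef s' (b + k%:Z))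
     - one2 (Lcoef s' (b + k%:Z)) *m one1 (Lcoef s (a - k%:Z))
         *m (g' ^+ k *: Rk k)).

Variant uq_relator : free_gen -> Prop :=
  | RelTriPlus (i j : 'I_n) of (i < j)%N :
      uq_relator (gvar (GenL Plus j i 0))
  | RelTriMinus (i j : 'I_n) of (i < j)%N :
      uq_relator (gvar (GenL Minus i j 0))
  | RelDiagPM (i : 'I_n) :
      uq_relator (gvar (GenL Plus i i 0) * gvar (GenL Minus i i 0) - 1)
  | RelDiagMP (i : 'I_n) :
      uq_relator (gvar (GenL Minus i i 0) * gvar (GenL Plus i i 0) - 1)
  | RelQcV : uq_relator (gvar (GenQc n) * gvar (GenQcV n) - 1)
  | RelQVc : uq_relator (gvar (GenQcV n) * gvar (GenQc n) - 1)
  | RelCentral (g : gen n) :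
      uq_relator (gvar (GenQc n) * gvar g - gvar g * gvar (GenQc n))
  | RelRLLsame (s : sgn) (a b : int) (i j : 'I_(n * n)) :
      uq_relator (RLLrel s s 1 1 a b i j)
  | RelRLLmixed (a b : int) (i j : 'I_(n * n)) :
      uq_relator
        (RLLrel Plus Minus (gvar (GenQcV n)) (gvar (GenQc n)) a b i j).

End Relations.

(* Mapping l^+-_ij[r] to the (i, j) entry of the identity matrix if r = 0 and *)
(* to 0 otherwise, and q^c to 1, kills the relators, so 1 is not in the ideal. *)
Section ScalarRLL.
Variables (C : fieldType) (A : nzRingType) (phi : {rmorphism A -> C}) (n : nat).

Let tens_scal (c : C) :
  (c%:M *t 1%:M = c%:M :> 'M[C]_(n * n)) * (1%:M *t c%:M = c%:M :> 'M[C]_(n * n)).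
Proof.
split; apply/matrixP => i j;
  case: (mxtens_indexP i) => i0 i1; case: (mxtens_indexP j) => j0 j1;
  rewrite tensmxE !mxE (can_eq (@mxtens_indexK _ _)) xpair_eqE;
  by do 2!case: eqP => _; rewrite /= ?mulr1 ?mul1r ?mulr0 ?mul0r.
Qed.

Lemma scalar_RLL (X Y : 'M[A]_n) (M : 'M[A]_(n * n)) (g g' : A) (c d : C) :
  map_mx phi X = c%:M -> map_mx phi Y = d%:M -> phi g = 1 -> phi g' = 1 ->
  map_mx phi ((g *: M) *m (X *t 1%:M) *m (1%:M *t Y)
              - (1%:M *t Y) *m (X *t 1%:M) *m (g' *: M)) = 0.
Proof.
move=> Xc Yd g1 g'1.
rewrite map_mxB !map_mxM !map_mxZ !map_mxT !map_mx1 Xc Yd g1 g'1 /=.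
rewrite !scale1r !tens_scal -mulmxA -!scalar_mxM.
by rewrite scalar_mxC mulrC subrr.
Qed.

End ScalarRLL.

Section Counit.
Variables (C : fieldType) (n : nat) (q : C) (f : fps C).
Local Notation free_gen := (freealg C (gen n)).

Let eps_gen (g : gen n) : C :=
  match g with
  | GenL _ i j r => ((i == j) && (r == 0%N))%:R
  | _ => 1
  end.

Definition eps_mon (m : {fmonom gen n}) : C := \prod_(g <- fmonom_val m) eps_gen g.

Lemma eps_mon_morph : mmorphism eps_mon.
Proof.
split=> [x y|]; last by rewrite /eps_mon fm1 big_nil.
by rewrite /eps_mon fmM big_cat.
Qed.

HB.instance Definition _ := isMultiplicative.Build _ _ eps_mon eps_mon_morph.

Let eps : free_gen -> C := mmap idfun eps_mon.

Let eps0 : eps 0 = 0. Proof. exact: rmorph0. Qed.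
Let eps1 : eps 1 = 1. Proof. exact: rmorph1. Qed.
Let epsB x y : eps (x - y) = eps x - eps y. Proof. exact: rmorphB. Qed.
Let epsM x y : eps (x * y) = eps x * eps y. Proof. exact: rmorphM. Qed.
Let epsV g : eps (fvar C g) = eps_gen g.
Proof. by rewrite /eps mmapU mul1r /= /eps_mon fmuE big_seq1. Qed.

HB.instance Definition _ := GRing.RMorphism.copy eps (mmap idfun eps_mon).

Let eps_Lcoef s a : map_mx eps (@Lcoef C n s a) = ((a == 0)%:R)%:M.
Proof.
apply/matrixP => i j; rewrite !mxE.
case: s; case: a => [[|r]|r] /=; rewrite ?epsV ?eps0 /= ?andbT ?andbF ?mul0rn //.
Qed.

Let epsX1 g k : eps g = 1 -> eps (g ^+ k) = 1.
Proof. by move=> g1; rewrite -(expr1n _ k) -[in RHS]g1; apply: rmorphXn. Qed.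

Let eps_RLL s s' g g' a b : eps g = 1 -> eps g' = 1 ->
  map_mx eps (RLLrel q f s s' g g' a b) = 0.
Proof.
move=> g1 g'1; rewrite /RLLrel map_mx_sum big1 // => k _.
by apply: scalar_RLL; [exact: eps_Lcoef | exact: eps_Lcoef
  | exact: epsX1 | exact: epsX1].
Qed.

Let eps_comm x y : eps (x * y - y * x) = 0.
Proof.
rewrite epsB; apply/eqP; rewrite subr_eq0; apply/eqP.
exact: etrans (epsM x y) (etrans (mulrC _ _) (esym (epsM y x))).
Qed.

Let eps_inv x y : eps x = 1 -> eps y = 1 -> eps (x * y - 1) = 0.
Proof. by move=> x1 y1; rewrite epsB epsM eps1 x1 y1 mulr1 subrr. Qed.

Lemma uq_relator_eps x : uq_relator q f x -> eps x = 0.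
Proof.
case=> [i j ij|i j ij|i|i|||g|s a b i j|a b i j].
- by rewrite epsV /= -val_eqE /= (gtn_eqF ij).
- by rewrite epsV /= -val_eqE /= (ltn_eqF ij).
- by apply: eps_inv; rewrite epsV /= eqxx.
- by apply: eps_inv; rewrite epsV /= eqxx.
- by apply: eps_inv; rewrite epsV.
- by apply: eps_inv; rewrite epsV.
- exact: eps_comm.
- have := @eps_RLL s s 1 1 a b eps1 eps1.
  by move=> /matrixP /(_ i j); rewrite !mxE.
- have := @eps_RLL Plus Minus (fvar C (GenQcV n)) (fvar C (GenQc n)) a b
    (epsV _) (epsV _).
  by move=> /matrixP /(_ i j); rewrite !mxE.
Qed.

Lemma uq_ideal_proper : ~ ideal_gen (@uq_relator C n q f) 1.
Proof.
move=> /(_ (fun x => eps x = 0)) h.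
have : eps 1 = 0.
  apply: h; last exact: uq_relator_eps.
  split=> [|x y x0 y0|x y y0|x y x0]; first exact: eps0.
  - by rewrite epsB x0 y0 subrr.
  - by rewrite epsM y0 mulr0.
  - by rewrite epsM x0 mul0r.
by move/eqP; rewrite eps1 oner_eq0.
Qed.

End Counit.

Section QuantumAffine.
Variables (C : fieldType) (n : nat) (q : C) (f : fps C).

Definition Uq : Type := quotalg (tsideal_gen (@uq_ideal_proper C n q f)).
HB.instance Definition _ := GRing.Algebra.on Uq.

(* L^+(u) as a power series in u, and L^-(u) as a power series in u^-1. *)
Definition Lser (s : sgn) : 'M[fps Uq]_n :=
  \matrix_(i, j) Fps (fun r => quot_pi _ (fvar C (GenL s i j r)) : Uq).

End QuantumAffine.

Arguments Lser {C n q f}.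

Section QuantumDeterminant.
Variables (C : fieldType) (A : algType C) (n : nat) (q : C).

(* The substitution u |-> u q^m in a series in u (Plus) or u^-1 (Minus). *)
Definition qshift (s : sgn) (m : nat) (x : fps A) : fps A :=
  fps_dil (if s is Plus then q ^+ m else q ^- m) x.

Definition fps_scal (c : C) : fps A := fps_const c%:A.

Definition Dmat : 'M[fps A]_n :=
  diag_mx (\row_(i < n) fps_scal (q ^ (n%:Z - 1 - (2 * i)%:Z))).

Definition perm_length (p : 'S_n) : nat :=
  #|[set ij : 'I_n * 'I_n | (ij.1 < ij.2)%N && (p ij.2 < p ij.1)%N]|.

(* \prod_(i < n) multiplies its factors from left to right. *)
Definition qdet (s : sgn) (L : 'M[fps A]_n) : fps A :=
  \sum_(p : 'S_n) fps_scal ((- q) ^- perm_length p) *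
    \prod_(i < n) qshift s (2 * n - 2 - 2 * i) (L (p i) i).

End QuantumDeterminant.

Arguments Dmat {C A n}.

(* Main.v *)
Require Import Defs.
From HB Require Import structures.
From mathcomp Require Import all_boot all_order all_algebra perm.
From mathcomp Require boolp.
From mathcomp Require Import reals complex mxtens.
From mathcomp Require Import ring zify.

(** Why the theorem holds. Fix one of the two signs. All computations take
    place in series of a single variable u, by comparing L(u) with its
    dilations L(c u) for nonzero scalars c.

    The sum that defines qdet L(u) contracts the q-sign eps of words with the
    columns of L(q^(2n-2) u), ..., L(q^2 u), L(u). At the ratio q^2 of two
    consecutive arguments the R-matrix degenerates to a q-antisymmetrizer, so
    that neighbouring columns satisfy the relations of the q-exterior algebra
    (exchange_qpair). Hence, for an arbitrary word j of column indices, the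
    contraction equals eps(j) qdet L(u) (contr_qalt, qalt_epsE).

    Two expansions follow. Let C_k be the contraction of the first n - 1
    factors with the word of all column indices but the first one, k being the
    row that is left out. Expanding along the last column shows that the row C
    times L(u) is a multiple of qdet L(u) times the first unit row, so that C_k
    is a multiple of qdet L(u) times the entry (1, k) of L(u)^-1
    (last_column_expansion). Replacing u by q^2 u shifts the list of factors by
    one place, so expanding qdet L(q^2 u) along its first column involves the
    entries (k, 1) of L(q^(2n) u) and the same C_k (first_column_expansion).
    The coefficients compare the q-signs of a word k w and of the word w k, and
    are proportional to the diagonal of D (eps_rotate). Thus the entry (1, 1)
    of the equation that determines z says that z qdet L(u) = qdet L(q^2 u),
    provided that qdet L(u) commutes with the entries of L(u)^-1.

    For this commutation one more factor L(u) is moved through the contraction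
    (contr_intertwine). It leaves a product of R-matrices behind, but these
    satisfy the q-exterior relations as well (Rblock_qpair), so their
    contraction with eps is eps times a matrix, which turns out to be a nonzero
    scalar (contr_Rblock); this scalar cancels (contr_exchange_comm).

    The defining relations give the exchange relation between L(x c u) and
    L(c u) once the scalar factor of R(x) has been cancelled on the level of
    coefficients (Rcomm_cancel, exchange_of_Rcomm). Finally L(u) and qdet L(u)
    are invertible because the constant term of L(u) is triangular
    (invertible_triangular, qdet_invertible). *)

Set Implicit Arguments.
Unset Strict Implicit.
Unset Printing Implicit Defensive.

Import GRing.Theory.
Local Open Scope ring_scope.

(** * q-signs of words *)

Section Words.
Variables (K : fieldType) (q : K) (n : nat).
Implicit Types (u v w : seq 'I_n) (i j k a b : 'I_n).

Fixpoint inversions w : nat :=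
  if w is i :: w' then count (fun j : 'I_n => (j < i)%N) w' + inversions w' else 0%N.

(** In the algebra with generators xi_i and relations xi_i xi_i = 0 and
    xi_j xi_i = - q^-1 xi_i xi_j for i < j, this is the coefficient by which
    the product of the letters of w differs from the increasing one. *)
Definition eps w : K := if uniq w then (- q) ^- inversions w else 0.

(** The relations of the q-exterior algebra, read on functions of words. *)
Definition qalt (V : lmodType K) (g : seq 'I_n -> V) :=
  forall u v i,
    g (u ++ i :: i :: v) = 0 /\
    forall j, (i < j)%N -> g (u ++ j :: i :: v) = - q^-1 *: g (u ++ i :: j :: v).

Lemma qalt_cons (V : lmodType K) (g : seq 'I_n -> V) i :
  qalt g -> qalt (fun w => g (i :: w)).
Proof. by move=> ag u v; apply: (ag (i :: u)). Qed.

Lemma inversions_swap u v i j : (i < j)%N ->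
  inversions (u ++ j :: i :: v) = (inversions (u ++ i :: j :: v)).+1.
Proof.
move=> ij; elim: u => [|k u IHu] /=; last first.
  by rewrite IHu !count_cat /=; lia.
rewrite ij (ltnNge j i) (ltnW ij) /=; lia.
Qed.

Lemma eps_qalt : qalt (eps : seq 'I_n -> K^o).
Proof.
move=> u v i; split=> [|j ij]; rewrite /eps.
  by rewrite cat_uniq /= inE eqxx /= !andbF.
have /perm_uniq -> : perm_eq (u ++ j :: i :: v) (u ++ i :: j :: v).
  rewrite perm_cat2l (perm_cat2r v [:: j; i] [:: i; j]).
  exact: (permEl (perm_catC [:: j] [:: i])).
case: ifP => _; last by rewrite scaler0.
by rewrite inversions_swap // exprS invfM invrN.
Qed.

Lemma weak_descentP w :
  sorted (fun i j => (i < j)%N) w \/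
  exists u v i j, (j <= i)%N /\ w = u ++ i :: j :: v.
Proof.
case: w => [|i w]; first by left.
elim: w i => [|j w IHw] i /=; first by left.
case: (ltnP i j) => ij /=; last by right; exists [::], w, i, j.
case: (IHw j) => [so|[u [v [i' [j' [ij' ->]]]]]]; first by left.
by right; exists (i :: u), v, i', j'.
Qed.

Lemma sorted_enum w : size w = n -> sorted (fun i j => (i < j)%N) w ->
  w = enum 'I_n.
Proof.
move=> sw so; apply: (inj_map val_inj); rewrite val_enum_ord.
have so' : sorted ltn (map val w) by rewrite sorted_map.
apply: (irr_sorted_eq ltn_trans ltnn) => //; first exact: iota_ltn_sorted.
have uw : uniq w.
  by move: so'; rewrite ltn_sorted_uniq_leq => /andP[/map_uniq].
move=> k; rewrite mem_iota /= add0n.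
apply/mapP/idP => [[i _ ->]|kn]; first exact: (ltn_ord i).
exists (Ordinal kn) => //.
have sub : {subset w <= enum 'I_n} by move=> i _; rewrite mem_enum.
have [|_ ->] := uniq_min_size uw sub; first by rewrite size_enum_ord sw.
by rewrite mem_enum.
Qed.

Lemma eps_sorted w : sorted (fun i j => (i < j)%N) w -> eps w = 1.
Proof.
move=> so; have inv0 : inversions w = 0%N.
  elim: w so => //= i w IHw so; rewrite IHw ?(path_sorted so) // addn0.
  have : all (fun j : 'I_n => (i < j)%N) w.
    by apply: order_path_min so => a b c; apply: ltn_trans.
  elim: w {IHw so} => //= j w IHw /andP[ij /IHw ->].
  by rewrite ltnNge (ltnW ij).
have : uniq w.
  by apply: sorted_uniq so => [a b c|i]; [apply: ltn_trans | rewrite ltnn].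
by rewrite /eps inv0 expr0 invr1 => ->.
Qed.

Lemma sorted_enum_ord : sorted (fun i j : 'I_n => (i < j)%N) (enum 'I_n).
Proof.
have := iota_ltn_sorted 0 n; rewrite -val_enum_ord sorted_map.
by [].
Qed.

(** Bubble sort: exchanging the two letters of a descent removes one inversion
    and multiplies h and eps by the same scalar, while a weak descent with
    equal letters makes both vanish. A word of length n without weak descents
    lists all the letters in order. *)
Lemma qalt_epsE (V : lmodType K) (h : seq 'I_n -> V) w :
  qalt h -> size w = n -> h w = eps w *: h (enum 'I_n).
Proof.
move=> ah; have [m] := ubnP (inversions w); elim: m w => // m IHm w wm sw.
case: (weak_descentP w) => [so|[u [v [i [j [ij ew]]]]]].
  by rewrite -(sorted_enum sw so) eps_sorted // scale1r.
move: ij; rewrite leq_eqVlt => /orP[/eqP/val_inj eji | ji].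
  rewrite ew eji; have [-> _] := ah u v i.
  by have [-> _] := eps_qalt u v i; rewrite scale0r.
have [_ /(_ i ji) hE] := ah u v j.
have [_ /(_ i ji) eE] := eps_qalt u v j.
rewrite ew hE eE IHm ?scalerA //.
  by move: wm; rewrite ew inversions_swap.
by apply: etrans sw; rewrite ew !size_cat.
Qed.

End Words.

(** * Contracting a function on words with matrices *)

Section Contraction.
Variables (n : nat) (B : nzRingType).
Implicit Types (T : nat -> 'I_n -> 'I_n -> B) (g : seq 'I_n -> B).

(** The row vector g, whose coordinates are indexed by words, times the tensor
    product of the matrices T 0, T 1, and so on; contrE is the explicit sum.
    Peeling off first letters avoids splitting sums over tuples, and taking
    infinite families T avoids any bookkeeping of lengths. The values of g
    stand to the right of the entries of T. *)
Fixpoint contr T g (w : seq 'I_n) : B :=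
  if w is j :: w' then
    \sum_i T 0%N i j * contr (fun k => T k.+1) (fun u => g (i :: u)) w'
  else g [::].

Lemma eq_contr T T' g g' w : (forall k i j, T k i j = T' k i j) ->
  (forall u, size u = size w -> g u = g' u) -> contr T g w = contr T' g' w.
Proof.
elim: w T T' g g' => [|j w IHw] T T' g g' eT eg /=; first exact: eg.
apply: eq_bigr => i _; rewrite eT; congr (_ * _).
by apply: IHw => // u su; apply: eg => /=; rewrite su.
Qed.

Lemma contr_mull T g (y : B) w : (forall k i j, T k i j * y = y * T k i j) ->
  contr T (fun u => y * g u) w = y * contr T g w.
Proof.
elim: w T g => [|j w IHw] T g yT //=.
rewrite mulr_sumr; apply: eq_bigr => i _.
by rewrite IHw // !mulrA yT.
Qed.

Lemma contr_mulr T g (y : B) w :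
  contr T (fun u => g u * y) w = contr T g w * y.
Proof.
elim: w T g => [|j w IHw] T g //=.
by rewrite mulr_suml; apply: eq_bigr => i _; rewrite IHw mulrA.
Qed.

Lemma contr_sum (I : finType) T (g : I -> seq 'I_n -> B) w :
  contr T (fun u => \sum_i g i u) w = \sum_i contr T (g i) w.
Proof.
elim: w T g => [|j w IHw] T g //=.
rewrite exchange_big; apply: eq_bigr => i _ /=.
by rewrite (IHw _ (fun x u => g x (i :: u))) mulr_sumr.
Qed.

(** Expansion along the last column. The entry of that column has to be moved
    across the value of g, hence the commutation hypothesis. *)
Lemma contr_rcons T g w j :
  (forall k a b u, T k a b * g u = g u * T k a b) ->
  contr T g (rcons w j) =
  \sum_i contr T (fun u => g (rcons u i)) w * T (size w) i j.
Proof.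
elim: w T g => [|j' w IHw] T g cg /=.
  by apply: eq_bigr => i _; rewrite cg.
under [RHS]eq_bigr do rewrite mulr_suml.
rewrite exchange_big; apply: eq_bigr => i _ /=.
rewrite IHw => [|k a b u]; last exact: cg.
by rewrite mulr_sumr; apply: eq_bigr => k _; rewrite mulrA.
Qed.

End Contraction.

Lemma rmorph_contr (n : nat) (B B' : nzRingType) (phi : {rmorphism B -> B'})
    (T : nat -> 'I_n -> 'I_n -> B) g w :
  phi (contr T g w) = contr (fun k i j => phi (T k i j)) (fun u => phi (g u)) w.
Proof.
elim: w T g => [|j w IHw] T g //=.
by rewrite rmorph_sum; apply: eq_bigr => i _; rewrite rmorphM IHw.
Qed.

Lemma big_tuple_cons (I : finType) (V : nmodType) m (F : m.+1.-tuple I -> V) :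
  \sum_t F t = \sum_i \sum_(t : m.-tuple I) F [tuple of i :: t].
Proof.
rewrite pair_big /=.
rewrite (reindex (fun p : I * m.-tuple I => [tuple of p.1 :: p.2])) //=.
exists (fun t : m.+1.-tuple I => (thead t, behead_tuple t)) => [[i t] _|t _] /=.
  by rewrite theadE; congr (_, _); apply: val_inj.
by rewrite [RHS]tuple_eta; apply: val_inj.
Qed.

Lemma contrE (n m : nat) (B : nzRingType) (T : nat -> 'I_n -> 'I_n -> B) g
    (w : m.-tuple 'I_n) :
  contr T g w =
  \sum_(t : m.-tuple 'I_n) (\prod_(k < m) T k (tnth t k) (tnth w k)) * g t.
Proof.
elim: m T g w => [|m IHm] T g w.
  rewrite (tuple0 w) /= (big_pred1 [tuple]) => [|t]; last by rewrite [t]tuple0.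
  by rewrite big_ord0 mul1r.
case/tupleP: w => j w /=; rewrite big_tuple_cons; apply: eq_bigr => i _.
rewrite IHm mulr_sumr; apply: eq_bigr => t _.
rewrite big_ord_recl !tnth0 !mulrA; congr (_ * _ * _).
by apply: eq_bigr => k _; rewrite !tnthS.
Qed.

Section Alternation.
Variables (K : fieldType) (q : K) (n : nat) (B : algType K).

(** Let psi_a and psi'_b be the sums over i of xi_i S i a and xi_i T i b, with
    the xi_i generating the q-exterior algebra. Comparing the coefficients of
    xi_i xi_j, the two clauses say that psi_a psi'_a = 0 and that
    psi_b psi'_a = - q^-1 psi_a psi'_b for a < b. *)
Definition qpair (S T : 'I_n -> 'I_n -> B) := forall i j : 'I_n, (i < j)%N ->
  (forall a, S i a * T j a = q^-1 *: (S j a * T i a)) /\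
  (forall a b : 'I_n, (a < b)%N ->
     S i b * T j a - q^-1 *: (S j b * T i a) =
     - q^-1 *: (S i a * T j b - q^-1 *: (S j a * T i b))).

Lemma sum_ltn_split (F : 'I_n -> 'I_n -> B) :
  \sum_i \sum_j F i j =
  \sum_i F i i + \sum_(i : 'I_n) \sum_(j : 'I_n | (i < j)%N) (F i j + F j i).
Proof.
have -> : \sum_(i : 'I_n) \sum_(j : 'I_n | (i < j)%N) (F i j + F j i) =
   \sum_(i : 'I_n) \sum_(j : 'I_n | (i < j)%N) F i j
   + \sum_(i : 'I_n) \sum_(j : 'I_n | (j < i)%N) F i j.
  under eq_bigr do rewrite big_split.
  rewrite big_split; congr (_ + _) => /=.
  by rewrite (exchange_big_dep predT).
rewrite -!big_split /=; apply: eq_bigr => i _.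
rewrite (bigD1 i) //= (bigID (fun j : 'I_n => (i < j)%N)) /=; congr (_ + (_ + _)).
  by apply: eq_bigl => j; rewrite -val_eqE /=; lia.
by apply: eq_bigl => j; rewrite -val_eqE /=; lia.
Qed.

(** Since g is q-alternating, the double sum over the letters standing in two
    neighbouring places folds onto i < i', and its coefficients become the
    quantum minors of size 2 that occur in qpair. *)
Lemma contr_qalt (T : nat -> 'I_n -> 'I_n -> B) (g : seq 'I_n -> B) :
  (forall k, qpair (T k) (T k.+1)) -> qalt q g -> qalt q (contr T g).
Proof.
move=> pT ag u; elim: u T g pT ag => [|k u IHu] T g pT ag v j; last first.
  split=> [|j' jj'] /=.
    rewrite big1 // => i _.
    have [-> _] := IHu _ (fun w => g (i :: w)) (fun k => pT k.+1) (qalt_cons i ag) v j.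
    by rewrite mulr0.
  rewrite scaler_sumr; apply: eq_bigr => i _.
  have [_ ->] := IHu _ (fun w => g (i :: w)) (fun k => pT k.+1) (qalt_cons i ag) v j => //.
  by rewrite scalerAr.
pose G i i' := contr (fun k => T k.+2) (fun w => g (i :: i' :: w)) v.
have G0 i : G i i = 0.
  rewrite -[RHS](mulr0 (G i i)) -contr_mulr; apply: eq_contr => // w _.
  by rewrite mulr0; have [-> _] := ag [::] w i.
have Gs (i i' : 'I_n) : (i < i')%N -> G i' i = - q^-1 *: G i i'.
  move=> ii'; rewrite /G -[RHS]mulr_algl -contr_mull.
    apply: eq_contr => // w _; rewrite mulr_algl.
    by have [_ ->] := ag [::] w i.
  by move=> *; rewrite mulr_algl mulr_algr.
have E a b : contr T g (a :: b :: v) =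
    \sum_(i : 'I_n) \sum_(i' : 'I_n | (i < i')%N)
      (T 0 i a * T 1 i' b - q^-1 *: (T 0 i' a * T 1 i b)) * G i i'.
  rewrite /= (eq_bigr (fun i => \sum_i' T 0%N i a * T 1%N i' b * G i i')); last first.
    by move=> i _; rewrite mulr_sumr; apply: eq_bigr => i' _; rewrite mulrA.
  rewrite sum_ltn_split big1 => [|i _]; last by rewrite G0 mulr0.
  rewrite add0r; apply: eq_bigr => i _; apply: eq_bigr => i' ii'.
  by rewrite (Gs _ _ ii') mulrBl scaleNr mulrN -scalerAr -scalerAl.
split=> [|j' jj']; rewrite !cat0s !E.
  rewrite big1 // => i _; rewrite big1 // => i' ii'.
  by have [-> _] := pT 0%N _ _ ii'; rewrite subrr mul0r.
rewrite scaler_sumr; apply: eq_bigr => i _.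
rewrite scaler_sumr; apply: eq_bigr => i' ii'.
by have [_ e] := pT 0%N _ _ ii'; rewrite (e _ _ jj') -scalerAl.
Qed.

End Alternation.

(** * The exchange relation and the R-matrix *)

Section Exchange.
Variables (K : fieldType) (q : K) (n : nat).

(** R preserves the unordered pair of indices: the entry of R - x R~ in row
    (i, j) is Rdiag x i j in column (i, j) and Rswap x i j in column (j, i).
    The same pattern for R~ alone is given by Rt_diag and Rt_swap below. *)
Definition Rdiag (x : K) (i j : 'I_n) : K :=
  if i == j then q - q^-1 * x else 1 - x.
Definition Rswap (x : K) (i j : 'I_n) : K :=
  if i == j then 0 else (q - q^-1) * (if (i < j)%N then 1 else x).

(** The entry in row (i, j) and column (k, l) of the relation
    (R - x R~) S_1 T_2 = T_2 S_1 (R - x R~). *)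
Definition exchange (B : algType K) x (S T : 'I_n -> 'I_n -> B) :=
  forall i j k l,
    Rdiag x i j *: (S i k * T j l) + Rswap x i j *: (S j k * T i l) =
    Rdiag x k l *: (T j l * S i k) + Rswap x l k *: (T j k * S i l).

Hypotheses (q_neq0 : q != 0) (q2_neq1 : q ^+ 2 != 1).

(** At x = q^2 the matrix R - x R~ is 1 - q^2 times a q-antisymmetrizer: its
    columns (k, k) vanish and its columns (k, l) and (l, k) are proportional.
    This passes to the left-hand side of the relation, which is made of
    quantum minors of size 2. *)
Lemma exchange_qpair (B : algType K) (S T : 'I_n -> 'I_n -> B) :
  exchange (q ^+ 2) S T -> qpair q S T.
Proof.
move=> ST i j ij; have ij' : (i == j) = false by rewrite -val_eqE /=; lia.
have c0 : 1 - q ^+ 2 != 0 by rewrite subr_eq0 eq_sym.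
have dE : q - q^-1 = - ((1 - q ^+ 2) * q^-1) by field.
have E a b : Rdiag (q ^+ 2) i j *: (S i a * T j b)
    + Rswap (q ^+ 2) i j *: (S j a * T i b) =
    (1 - q ^+ 2) *: (S i a * T j b - q^-1 *: (S j a * T i b)).
  by rewrite /Rdiag /Rswap ij' ij mulr1 dE scalerBr scaleNr scalerA.
split=> [a|a b ab].
  have := ST i j a a; rewrite E /Rdiag /Rswap !eqxx scale0r addr0.
  have -> : q - q^-1 * q ^+ 2 = 0 by field.
  by rewrite scale0r => /eqP; rewrite scaler_eq0 (negbTE c0) subr_eq0 => /eqP.
have e1 := ST i j a b; have e2 := ST i j b a.
have ab' : (a == b) = false by rewrite -val_eqE /=; lia.
have ba' : (b == a) = false by rewrite eq_sym.
apply: (scalerI c0); rewrite -E e2 scalerA mulrC -scalerA -E e1.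
rewrite /Rdiag /Rswap ab' ba' ab (ltnNge b a) (ltnW ab) /= scalerDr !scalerA.
by rewrite addrC; congr (_ *: _ + _ *: _); field.
Qed.

End Exchange.

Section RBlock.
Variables (K : fieldType) (q : K) (m : nat).
Local Notation n := m.+1.
Hypotheses (q_neq0 : q != 0).
Implicit Types (x y : K) (i j a b : 'I_n).

(** The coefficient of e_ia in the first tensor factor of R - x R~, an operator
    on the second factor. In this way the R-matrix is itself a matrix with
    entries in a noncommutative ring, and can be contracted. *)
Definition Rblock x i a : 'M[K]_n :=
  \matrix_(p, r) (Rdiag q x i p *+ ((i == a) && (p == r))
                  + Rswap q x i p *+ ((i == r) && (p == a))).

Lemma RblockM x y i j a b (p r : 'I_n) :
  (Rblock x i a * Rblock y j b) p r =
  Rdiag q x i p * Rdiag q y j p *+ [&& i == a, j == b & p == r]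
  + Rdiag q x i p * Rswap q y j p *+ [&& i == a, j == r & p == b]
  + Rswap q x i p * Rdiag q y j i *+ [&& p == a, j == b & i == r]
  + Rswap q x i p * Rswap q y j i *+ [&& p == a, j == r & i == b].
Proof.
rewrite mxE.
under eq_bigr => k _ do rewrite !mxE mulrDl.
rewrite big_split /= (bigD1 p) //= big1 ?addr0 => [|k kp]; last first.
  by rewrite (eq_sym p) (negbTE kp) andbF mulr0n mul0r.
rewrite [X in _ + X](bigD1 i) //= big1 ?addr0 => [|k kp]; last first.
  by rewrite (eq_sym i) (negbTE kp) mulr0n mul0r.
rewrite !eqxx andbT andTb !mulrDr !mulrnAr !mulrnAl -!mulrnA !mulnb addrA.
by congr (_ *+ _ + _ *+ _ + _ *+ _ + _ *+ _);
   do !case: (_ == _ ).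
Qed.

(** Splits on the remaining comparisons of indices; these are compared as
    natural numbers, so that lia discards the inconsistent patterns. *)
Ltac nat_cases :=
  repeat (match goal with
  | |- context [if (?u < ?v)%N then _ else _] =>
      let h := fresh in case: (ltnP u v) => h; try (exfalso; lia)
  | |- context [?u == ?v] =>
      let h := fresh in case: (eqVneq u v) => h; try (exfalso; lia); try subst
  end; rewrite ?mulr0n ?mulr1n ?mulr0 ?mul0r ?addr0 ?add0r ?subr0 ?oppr0 ?eqxx //=).

(** An instance of the Yang-Baxter equation, at the ratio q^2 where the third
    R-matrix is a q-antisymmetrizer. *)
Lemma Rblock_qpair x : qpair q (Rblock (q ^+ 2 * x)) (Rblock x).
Proof.
have subE (M N : 'M[K]_n) c p r : (M - c *: N) p r = M p r - c * N p r.
  by rewrite !mxE.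
have scaleE (M : 'M[K]_n) c p r : (c *: M) p r = c * M p r by rewrite mxE.
move=> i j ij; split=> [a|a b ab]; apply/matrixP => p r.
  rewrite scaleE !RblockM /Rdiag /Rswap -!val_eqE /=.
  move: (nat_of_ord i) (nat_of_ord j) (nat_of_ord a) (nat_of_ord p)
    (nat_of_ord r) ij => {}i {}j {}a {}p {}r ij.
  by nat_cases; field.
rewrite scaleE !subE !RblockM /Rdiag /Rswap -!val_eqE /=.
move: (nat_of_ord i) (nat_of_ord j) (nat_of_ord a) (nat_of_ord b)
  (nat_of_ord p) (nat_of_ord r) ij ab => {}i {}j {}a {}b {}p {}r ij ab.
nat_cases.
all: by field.
Qed.
End RBlock.

(** * Exchange with a further factor *)

Section Theta.
Variables (K : fieldType) (q : K) (m : nat).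
Local Notation n := m.+1.
Hypotheses (q_neq0 : q != 0).

Lemma eps_alg_qalt (B : algType K) : qalt q (fun u : seq 'I_n => (eps q u)%:A : B).
Proof.
move=> u v i; have [e0 eS] := eps_qalt q u v i; split=> [|j ij].
  by rewrite e0 scale0r.
by rewrite eS // scalerA.
Qed.

(** Read a product of blocks as a path of the index on which they act. A path
    that starts at b can only move at a letter b of the word, so up to the last
    letter it stays at b, the two words agree, and each block acts by the
    scalar 1 - X k. *)
Lemma contr_Rblock_last (X : nat -> K) (g : seq 'I_n -> K) w (b r : 'I_n) :
  b \notin w ->
  contr (fun k => Rblock q (X k)) (fun u => (g u)%:A) (rcons w b) b r =
  (\prod_(k < size w) (1 - X k)) *
  \sum_c g (rcons w c) * Rblock q (X (size w)) c b b r.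
Proof.
elim: w X g => [|j w IHw] X g /=.
  move=> _; rewrite big_ord0 mul1r summxE; apply: eq_bigr => c _.
  by rewrite mulr_algr mxE.
rewrite inE negb_or => /andP[bj bw]; rewrite summxE (bigD1 j) //= big1 ?addr0.
  rewrite big_ord_recl -mulrA -(IHw (fun k => X k.+1) (fun u => g (j :: u)) bw).
  rewrite mxE (bigD1 b) //= big1 ?addr0 => [|k kb]; rewrite mxE eqxx.
    by rewrite eqxx (negbTE bj) andbF mulr0n addr0 /Rdiag eq_sym (negbTE bj).
  by rewrite (negbTE bj) andbF mulr0n addr0 (eq_sym b) (negbTE kb) mulr0n mul0r.
move=> i ij; rewrite mxE big1 // => k _.
by rewrite mxE (negbTE ij) (negbTE bj) andbF !mulr0n addr0 mul0r.
Qed.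

Definition Rtheta (X : nat -> K) := (\prod_(k < m) (1 - X k)) * (q - q^-1 * X m).

(** The contraction is eps w times a fixed matrix. Its row b can be computed on
    any word of distinct letters, and a word that ends in b makes the
    computation immediate: a move to c <> b in the last place would repeat a
    letter, and eps vanishes on such words. *)
Lemma contr_Rblock (X : nat -> K) (w : seq 'I_n) :
  (forall k, X k = q ^+ 2 * X k.+1) -> size w = n ->
  contr (fun k => Rblock q (X k)) (fun u => (eps q u)%:A) w =
  (eps q w * Rtheta X)%:A :> 'M[K]_n.
Proof.
move=> XS sw.
pose h : seq 'I_n -> 'M[K]_n :=
  contr (fun k => Rblock q (X k)) (fun u => (eps q u)%:A).
have ah : qalt q h.
  apply: contr_qalt; last exact: eps_alg_qalt.
  by move=> k; rewrite XS; apply: Rblock_qpair.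
rewrite -/(h w) (qalt_epsE ah sw) -scalerA; congr (_ *: _).
apply/matrixP => b r.
pose v := rem b (enum 'I_n).
have vb : perm_eq (rcons v b) (enum 'I_n).
  by rewrite perm_rcons perm_sym perm_to_rem // mem_enum.
have uv : uniq (rcons v b) by rewrite (perm_uniq vb) enum_uniq.
have sv : size v = m by have := perm_size vb; rewrite size_rcons size_enum_ord => -[].
have e0 : eps q (rcons v b) != 0.
  by rewrite /eps uv invr_eq0 expf_neq0 // oppr_eq0.
have bv : b \notin v by move: uv; rewrite rcons_uniq => /andP[].
have srv : size (rcons v b) = n by rewrite size_rcons sv.
have := congr1 (fun M : 'M[K]_n => M b r) (qalt_epsE ah srv).
rewrite [X in _ = X -> _]mxE => hE; apply: (mulfI e0); rewrite -hE.
rewrite /h (contr_Rblock_last X (@eps _ q n)) // sv (bigD1 b) //= [X in _ + X]big1 ?addr0.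
  rewrite !mxE !eqxx /= /Rdiag /Rswap !eqxx mul0rn addr0 /Rtheta.
  by case: (b == r); rewrite ?mulr1n ?mulr0n; ring.
move=> c cb; suff -> : eps q (rcons v c) = 0 by rewrite mul0r.
rewrite /eps rcons_uniq; suff -> : c \in v by [].
have : c \in rcons v b by rewrite (perm_mem vb) mem_enum.
by rewrite mem_rcons inE (negbTE cb).
Qed.

End Theta.

(** With index 0 for the space of X, the hypothesis is
    R_k0 l_k X_0 = X_0 l_k R_k0, and the conclusion is the resulting identity
    R_10 R_20 ... l_1 l_2 ... X_0 = X_0 l_1 l_2 ... R_10 R_20 ... between
    products over all the places of a word, applied to g. *)
Lemma contr_intertwine (n : nat) (E : nzRingType)
    (l R : nat -> 'I_n -> 'I_n -> E) (X : E) (g : seq 'I_n -> E) w :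
  (forall k k' i j a b, l k i j * R k' a b = R k' a b * l k i j) ->
  (forall k a b, \sum_i R k a i * l k i b * X = \sum_i X * l k a i * R k i b) ->
  (forall u, g u * X = X * g u) ->
  contr l (contr R g) w * X = X * contr R (contr l g) w.
Proof.
elim: w l R g => [|b w IHw] l R g lR RlX gX /=; first exact: gX.
pose l' k := l k.+1; pose R' k := R k.+1.
pose C i := contr l' (contr R' (fun u => g (i :: u))) w.
pose D i := contr R' (contr l' (fun u => g (i :: u))) w.
have CD i : C i * X = X * D i by apply: IHw => *; [exact: lR | exact: RlX | exact: gX].
transitivity (\sum_i (\sum_a R 0%N i a * l 0%N a b * X) * D i).
  rewrite mulr_suml; under [RHS]eq_bigr => i _ do rewrite mulr_suml.
  rewrite exchange_big; apply: eq_bigr => a _ /=.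
  rewrite contr_sum mulr_sumr mulr_suml; apply: eq_bigr => i _.
  rewrite contr_mull => [|k i' j]; last exact: lR.
  by rewrite -/(C i) -!mulrA CD !mulrA lR.
under [LHS]eq_bigr => i _ do rewrite RlX mulr_suml.
rewrite exchange_big mulr_sumr; apply: eq_bigr => a _ /=.
rewrite contr_sum !mulr_sumr; apply: eq_bigr => i _.
rewrite contr_mull => [|k i' j]; last by rewrite lR.
by rewrite -/(D i) !mulrA -(mulrA X) lR !mulrA.
Qed.

Section Central.
Variables (K : fieldType) (q : K) (m : nat) (B : algType K).
Local Notation n := m.+1.
Hypotheses (q_neq0 : q != 0).

Lemma sum_Rblockl x (a p : 'I_n) (Z : 'I_n -> 'I_n -> B) :
  \sum_i \sum_k Rblock q x a i p k *: Z i k =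
  Rdiag q x a p *: Z a p + Rswap q x a p *: Z p a.
Proof.
under eq_bigr => i _ do under eq_bigr => k _ do rewrite mxE scalerDl.
under eq_bigr => i _ do rewrite big_split.
rewrite big_split /=; congr (_ + _).
  rewrite (bigD1 a) //= [X in _ + X]big1 ?addr0 => [|i ia]; last first.
    by rewrite big1 // => k _; rewrite eq_sym (negbTE ia) mulr0n scale0r.
  rewrite (bigD1 p) //= big1 ?addr0 ?eqxx //= => k kp.
  by rewrite (eq_sym p) (negbTE kp) mulr0n scale0r.
rewrite (bigD1 p) //= [X in _ + X]big1 ?addr0 => [|i ip]; last first.
  by rewrite big1 // => k _; rewrite (eq_sym p) (negbTE ip) andbF mulr0n scale0r.
rewrite (bigD1 a) //= big1 ?addr0 ?eqxx //= => k ka.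
by rewrite (eq_sym a) (negbTE ka) mulr0n scale0r.
Qed.

Lemma sum_Rblockr x (b r : 'I_n) (Z : 'I_n -> 'I_n -> B) :
  \sum_i \sum_k Rblock q x i b k r *: Z i k =
  Rdiag q x b r *: Z b r + Rswap q x r b *: Z r b.
Proof.
under eq_bigr => i _ do under eq_bigr => k _ do rewrite mxE scalerDl.
under eq_bigr => i _ do rewrite big_split.
rewrite big_split /=; congr (_ + _).
  rewrite (bigD1 b) //= [X in _ + X]big1 ?addr0 => [|i ib]; last first.
    by rewrite big1 // => k _; rewrite (negbTE ib) mulr0n scale0r.
  rewrite (bigD1 r) //= big1 ?addr0 ?eqxx //= => k kr.
  by rewrite (negbTE kr) mulr0n scale0r.
rewrite (bigD1 r) //= [X in _ + X]big1 ?addr0 => [|i ir]; last first.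
  by rewrite big1 // => k _; rewrite (negbTE ir) mulr0n scale0r.
rewrite (bigD1 b) //= big1 ?addr0 ?eqxx //= => k kb.
by rewrite (negbTE kb) mulr0n scale0r.
Qed.

Lemma mulmx_scalarE (M : 'M[B]_n) (c : B) p r : (M *m c%:M) p r = M p r * c.
Proof.
rewrite mxE (bigD1 r) //= big1 ?addr0 => [|k kr]; last first.
  by rewrite mxE (negbTE kr) mulr0.
by rewrite mxE eqxx.
Qed.

(** The contraction of eps with the R-matrices is eps times the scalar Rtheta,
    so that in the intertwining relation every R-matrix is absorbed into one
    and the same scalar on both sides. *)
Lemma contr_exchange_comm (T : nat -> 'I_n -> 'I_n -> B) (L : 'M[B]_n)
    (X : nat -> K) :
  (forall k, X k = q ^+ 2 * X k.+1) -> Rtheta q m X != 0 ->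
  (forall k, qpair q (T k) (T k.+1)) ->
  (forall k, exchange q (X k) (T k) L) ->
  forall i j, contr T (fun u => (eps q u)%:A) (enum 'I_n) * L i j =
              L i j * contr T (fun u => (eps q u)%:A) (enum 'I_n).
Proof.
move=> XS th pT exT.
set d := contr T _ _.
(* The ring of matrices over B contains both kinds of factors: the entries of
   the T k as scalar matrices, the blocks of the R-matrices as matrices over K. *)
pose phi : K -> 'M[B]_n := fun c => (c%:A)%:M.
pose l k a b : 'M[B]_n := (T k a b)%:M.
pose R k a b : 'M[B]_n := map_mx (in_alg B) (Rblock q (X k) a b).
have scal_comm (c : B) (M : 'M[K]_n) :
    c%:M * map_mx (in_alg B) M = map_mx (in_alg B) M * c%:M.
  apply/matrixP => p r; rewrite [RHS]mulmx_scalarE [c%:M * _]mul_scalar_mx !mxE.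
  by rewrite mulr_algl mulr_algr.
have lR k k' i' j' a b : l k i' j' * R k' a b = R k' a b * l k i' j'.
  exact: scal_comm.
have RlX k a b : \sum_i R k a i * l k i b * L = \sum_i L * l k a i * R k i b.
  apply/matrixP => p r; rewrite !summxE.
  transitivity (\sum_i \sum_m Rblock q (X k) a i p m *: (T k i b * L m r)).
    apply: eq_bigr => i _; rewrite -mulrA [l _ _ _ * _]mul_scalar_mx mxE.
    by apply: eq_bigr => j _; rewrite !mxE mulr_algl.
  rewrite sum_Rblockl exT.
  transitivity (\sum_i \sum_m Rblock q (X k) i b m r *: (L p m * T k a i)).
    by rewrite sum_Rblockr.
  apply: eq_bigr => i _; rewrite -mulrA lR mulrA [RHS]mulmx_scalarE mxE mulr_suml.
  by apply: eq_bigr => j _; rewrite !mxE mulr_algr scalerAl.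
have phiL c : phi c * L = L * phi c.
  apply/matrixP => p r; rewrite [RHS]mulmx_scalarE [phi c * _]mul_scalar_mx mxE.
  by rewrite mulr_algl mulr_algr.
have := contr_intertwine (enum 'I_n) lR RlX (fun u => phiL (eps q u)).
have lE : contr l (fun u => phi (eps q u)) =1 
   (fun w => (contr T (fun u => (eps q u)%:A) w)%:M).
  by move=> w; rewrite rmorph_contr.
have epsB : qalt q (fun u : seq 'I_n => (eps q u)%:A : B) by exact: eps_alg_qalt.
have RE w : size w = n -> contr R (fun u => phi (eps q u)) w =
    phi (Rtheta q m X) * phi (eps q w).
  move=> sw; pose psi := map_mx (in_alg B) : 'M[K]_n -> 'M[B]_n.
  have phiE c : phi c = psi c%:A.
    apply/matrixP => p r; rewrite !mxE /=.
    by case: (p == r); rewrite ?mulr1n ?mulr0n ?mulr1 ?mulr0 ?scale0r.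
  have -> : contr R (fun u => phi (eps q u)) w =
      psi (contr (fun k => Rblock q (X k)) (fun u => (eps q u)%:A) w).
    rewrite [RHS](rmorph_contr (map_mx (in_alg B) : {rmorphism 'M[K]_n -> 'M[B]_n})).
    by apply: eq_contr => // u _; rewrite phiE.
  rewrite (contr_Rblock q_neq0 XS sw) -phiE /phi -[RHS]scalar_mxM.
  by rewrite mulr_algl scalerA mulrC.
have phi_comm c (M : 'M[B]_n) : M * phi c = phi c * M.
  apply/matrixP => p r; rewrite [LHS]mulmx_scalarE [phi c * _]mul_scalar_mx mxE.
  by rewrite mulr_algl mulr_algr.
have -> : contr l (contr R (fun u => phi (eps q u))) (enum 'I_n) =
    phi (Rtheta q m X) * d%:M.
  rewrite -lE -contr_mull => [|k a b]; last exact: phi_comm.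
  by apply: eq_contr => // u; rewrite size_enum_ord => su; rewrite RE.
have -> : contr R (contr l (fun u => phi (eps q u))) (enum 'I_n) =
    d%:M * phi (Rtheta q m X).
  transitivity (contr R (fun u => d%:M * phi (eps q u)) (enum 'I_n)).
    apply: eq_contr => // u; rewrite size_enum_ord => su; rewrite lE.
    rewrite (qalt_epsE (contr_qalt pT epsB) su) -/d /phi -[RHS]scalar_mxM.
    by rewrite mulr_algr.
  rewrite contr_mull => [|k a b]; last by rewrite -scal_comm.
  rewrite RE ?size_enum_ord // eps_sorted ?sorted_enum_ord //.
  by rewrite /phi scale1r mulr1.
move=> /matrixP dL i j; have := dL i j.
rewrite -mulrA [_%:M * (_ * _)]mul_scalar_mx mxE [_%:M * _]mul_scalar_mx mxE.
rewrite (mulrA L) mulmx_scalarE [(L * _) i j]mulmx_scalarE mulr_algl mulr_algr.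
exact: scalerI.
Qed.
End Central.

(** * Contractions and quantum determinants *)

Section EpsWords.
Variables (K : fieldType) (q : K) (m : nat).
Local Notation n := m.+1.
Hypothesis q_neq0 : q != 0.

Lemma inversions_rcons n' (w : seq 'I_n') k :
  inversions (rcons w k) = (inversions w + count (fun j : 'I_n' => (k < j)%N) w)%N.
Proof.
elim: w => //= j w ->; rewrite -cats1 count_cat /= addn0; lia.
Qed.

Lemma count_ltn_enum (k : 'I_n) :
  count (fun j : 'I_n => (j < k)%N) (enum 'I_n) = k.
Proof.
rewrite -(count_map val (fun j => (j < k)%N)) val_enum_ord.
move: (nat_of_ord k) (ltn_ord k) => {}k kn; have -> : m.+1 = (k + (m.+1 - k))%N by lia.
rewrite iotaD count_cat add0n.
rewrite (eq_in_count (a2 := predT)) => [|j]; last by rewrite mem_iota => /andP[].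
rewrite [X in (_ + X)%N](eq_in_count (a2 := pred0)) => [|j].
  by rewrite count_predT count_pred0 size_iota addn0.
by rewrite mem_iota /= => /andP[kj _]; rewrite ltnNge kj.
Qed.

(** If k :: w has no repetition, its first letter is larger than k other
    letters and smaller than m - k of them. The scalars that appear here are
    proportional to the diagonal entries of the matrix D. *)
Lemma eps_rotate k (w : seq 'I_n) : size w = m ->
  eps q (k :: w) = (- q) ^+ m * (- q) ^- (2 * k) * eps q (rcons w k).
Proof.
move=> sw; rewrite /eps rcons_uniq /=; case: ifP => [/andP[kw uw]|_]; last by rewrite mulr0.
have uk : uniq (k :: w) by rewrite /= kw.
have sub : {subset k :: w <= enum 'I_n} by move=> i _; rewrite mem_enum.
have [|_ kwE] := uniq_min_size uk sub; first by rewrite size_enum_ord /= sw.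
have pe : perm_eq (k :: w) (enum 'I_n) by apply: uniq_perm => //; apply: enum_uniq.
have cl : count (fun j : 'I_n => (j < k)%N) w = k.
  by rewrite -[RHS]count_ltn_enum -(seq.permP pe) /= ltnn.
have cg : (k + count (fun j : 'I_n => (k < j)%N) w = m)%N.
  rewrite -[X in (X + _)%N]cl; apply: etrans sw.
  rewrite -[RHS](count_predC (fun j : 'I_n => (j < k)%N)).
  congr (_ + _)%N; apply: eq_in_count => j jw /=.
  rewrite -leqNgt [RHS]leq_eqVlt; case: eqP => [/ord_inj kj|//].
  by rewrite kj jw in kw.
rewrite inversions_rcons cl; set c := count _ _ in cg *.
have q0 : - q != 0 by rewrite oppr_eq0.
have -> : (- q) ^+ m = (- q) ^+ k * (- q) ^+ c by rewrite -exprD cg.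
rewrite mul2n -addnn !exprD; field.
by rewrite !expf_neq0.
Qed.

End EpsWords.

Lemma inversions_sum n (w : seq 'I_n) (x : 'I_n) :
  inversions w =
  (\sum_(a < size w) \sum_(b < size w | a < b) (nth x w b < nth x w a))%N.
Proof.
elim: w => [|i w IHw] /=; first by rewrite big_ord0.
rewrite big_ord_recl /= IHw; congr (_ + _)%N.
  rewrite big_mkcond big_ord_recl /= add0n -sum1_count big_mkcond /=.
  by rewrite (big_nth x) big_mkord; apply: eq_bigr => b _; case: ifP.
apply: eq_bigr => a _; rewrite [RHS]big_mkcond big_ord_recl /= add0n big_mkcond.
by apply: eq_bigr => b _.
Qed.

Lemma inversions_perm n (p : 'S_n) : inversions [seq p i | i <- enum 'I_n] = perm_length p.
Proof.
case: n p => [|n] p.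
  rewrite /perm_length (eq_card0 (A := mem [set _ | _])) ?enum_ord0 // => -[[]]//.
have sE : size [seq p i | i <- enum 'I_n.+1] = n.+1 by rewrite size_map size_enum_ord.
rewrite (inversions_sum _ ord0) /perm_length -sum1_card.
rewrite (eq_bigl (fun ij : 'I_n.+1 * 'I_n.+1 =>
  (ij.1 < ij.2)%N && (p ij.2 < p ij.1)%N)); last by move=> ij; rewrite inE.
rewrite -(pair_big_dep predT (fun i j : 'I_n.+1 => (i < j)%N && (p j < p i)%N) (fun _ _ => 1%N)) /=.
have nthE (i : 'I_n.+1) : nth ord0 [seq p i | i <- enum 'I_n.+1] i = p i.
  by rewrite (nth_map ord0) ?size_enum_ord // nth_ord_enum.
rewrite sE; apply: eq_bigr => a _; rewrite -big_mkcondr /=.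
by apply: eq_bigl => b; rewrite !nthE.
Qed.

Section QdetContr.
Variables (K : fieldType) (q : K) (n : nat) (B : algType K).

(** Words with a repeated letter do not contribute, the others are the
    permutations. *)
Lemma contr_enum (T : nat -> 'I_n -> 'I_n -> B) :
  contr T (fun u => (eps q u)%:A) (enum 'I_n) =
  \sum_(p : 'S_n) (- q) ^- perm_length p *: \prod_(i < n) T i (p i) i.
Proof.
rewrite -[enum 'I_n]/(val (ord_tuple n)) contrE.
rewrite (bigID (fun t : n.-tuple 'I_n => uniq t)) /= [X in _ + X]big1 ?addr0; last first.
  by move=> t /negbTE ut; rewrite /eps ut scale0r mulr0.
pose h (p : 'S_n) : n.-tuple 'I_n := [tuple p i | i < n].
have hE (p : 'S_n) : h p = [seq p i | i <- enum 'I_n] :> seq _ by [].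
pose g (t : n.-tuple 'I_n) : 'S_n := insubd (1%g : 'S_n) (finfun (tnth t)).
rewrite (reindex h) /=; last first.
  exists g => [p _|t]; rewrite /g /h.
    rewrite -[RHS](valKd (1%g : 'S_n)); congr insubd.
    by apply/ffunP => i; rewrite ffunE tnth_mktuple; rewrite -pvalE.
  rewrite inE => ut; apply: eq_from_tnth => i.
  have inj_t : injectiveb (finfun (tnth t)).
    by apply/injectiveP => a b; rewrite !ffunE => /(tuple_uniqP _ ut).
  by rewrite tnth_mktuple -pvalE insubdK // ffunE.
apply: eq_big => [p|p _].
  by rewrite map_inj_uniq ?enum_uniq //; apply: perm_inj.
rewrite -(hE p) /eps hE map_inj_uniq ?enum_uniq; last exact: perm_inj.
rewrite inversions_perm mulr_algr; congr (_ *: _); apply: eq_bigr => i _.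
by rewrite tnth_mktuple tnth_ord_tuple.
Qed.
End QdetContr.

Section FpsAlgebra.
Variables (K : fieldType) (A : algType K).
Implicit Types (c : K) (s t : fps A).

Definition fps_scale c s : fps A := Fps (fun k => c *: s k).

Lemma fps_scaleA a b s : fps_scale a (fps_scale b s) = fps_scale (a * b) s.
Proof. by apply: fpsP => k /=; rewrite scalerA. Qed.
Lemma fps_scale1 : left_id 1 fps_scale.
Proof. by move=> s; apply: fpsP => k /=; rewrite scale1r. Qed.
Lemma fps_scaleDr : right_distributive fps_scale +%R.
Proof. by move=> a s t; apply: fpsP => k /=; rewrite scalerDr. Qed.
Lemma fps_scaleDl s : {morph fps_scale^~ s : a b / a + b}.
Proof. by move=> a b; apply: fpsP => k /=; rewrite scalerDl. Qed.

HB.instance Definition _ := GRing.Zmodule_isLmodule.Build K (fps A)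
  fps_scaleA fps_scale1 fps_scaleDr fps_scaleDl.

Lemma fps_scaleAl c s t : c *: (s * t) = c *: s * t.
Proof.
apply: fpsP => k /=; rewrite scaler_sumr.
by apply: eq_bigr => i _; rewrite scalerAl.
Qed.
Lemma fps_scaleAr c s t : c *: (s * t) = s * (c *: t).
Proof.
apply: fpsP => k /=; rewrite scaler_sumr.
by apply: eq_bigr => i _; rewrite scalerAr.
Qed.

HB.instance Definition _ := GRing.Lmodule_isLalgebra.Build K (fps A) fps_scaleAl.
HB.instance Definition _ := GRing.Lalgebra_isAlgebra.Build K (fps A) fps_scaleAr.

Lemma fps_dil_zmod_morphism c : zmod_morphism (@fps_dil K A c).
Proof. by move=> s t; apply: fpsP => k /=; rewrite scalerBr. Qed.

Lemma fps_dil_monoid_morphism c : monoid_morphism (@fps_dil K A c).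
Proof.
split=> [|s t]; apply: fpsP => k /=.
  by case: k => [|k]; rewrite ?scale1r ?scaler0.
rewrite scaler_sumr; apply: eq_bigr => i _.
by rewrite -scalerAl -scalerAr scalerA -exprD subnKC // -ltnS.
Qed.

Lemma fps_dil_scalable c : scalable (@fps_dil K A c).
Proof. by move=> a s; apply: fpsP => k /=; rewrite !scalerA mulrC. Qed.

HB.instance Definition _ c := GRing.isZmodMorphism.Build (fps A) (fps A)
  (@fps_dil K A c) (fps_dil_zmod_morphism c).
HB.instance Definition _ c := GRing.isMonoidMorphism.Build (fps A) (fps A)
  (@fps_dil K A c) (fps_dil_monoid_morphism c).
HB.instance Definition _ c := GRing.isScalable.Build K (fps A) (fps A) *:%R
  (@fps_dil K A c) (fps_dil_scalable c).

Lemma fps_dilM b c s : fps_dil b (fps_dil c s) = fps_dil (b * c) s.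
Proof. by apply: fpsP => k /=; rewrite scalerA exprMn. Qed.

Lemma fps_dil1 s : fps_dil (1 : K) s = s.
Proof. by apply: fpsP => k /=; rewrite expr1n scale1r. Qed.

Lemma fps_algE c : fps_const c%:A = c%:A :> fps A.
Proof. by apply: fpsP => k /=; case: eqP; rewrite ?scaler0. Qed.

End FpsAlgebra.

(** * Invertible series and triangular matrices *)

Definition invertible (A : nzRingType) (x : A) := exists y, y * x = 1 /\ x * y = 1.

Section Invertible.
Variable A : nzRingType.

Lemma invertible1 : invertible (1 : A).
Proof. by exists 1; rewrite mulr1. Qed.

Lemma invertibleM (x y : A) : invertible x -> invertible y -> invertible (x * y).
Proof.
move=> [x' [x'x xx']] [y' [y'y yy']]; exists (y' * x'); split.
  by rewrite mulrA -(mulrA y') x'x mulr1.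
by rewrite mulrA -(mulrA x) yy' mulr1.
Qed.

Lemma invertible_geometric (x : A) m : x ^+ m = 0 -> invertible (1 - x).
Proof.
move=> xm; have e : (1 - x) * \sum_(i < m) x ^+ i = 1.
  by rewrite -[1 - x]opprB mulNr -subrX1 xm sub0r opprK.
exists (\sum_(i < m) x ^+ i); split=> //.
rewrite -[RHS]e; apply: commr_sym.
by apply: commr_sum => i _; apply/commrX/commr_sym/commrB; [exact: commr1|].
Qed.

End Invertible.

Section FpsInvertible.
Variable A : nzRingType.

Lemma fps_coef0M (s t : fps A) : (s * t) 0%N = s 0%N * t 0%N.
Proof. by rewrite /= big_ord_recl big_ord0 addr0. Qed.

Lemma fps_coef0_prod (I : finType) (F : I -> fps A) :
  (\prod_i F i) 0%N = \prod_i F i 0%N.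
Proof. exact: (big_morph (fun x : fps A => x 0%N) fps_coef0M erefl). Qed.

Lemma fps_coefM_eq (s s' t t' : fps A) k :
  (forall i, (i <= k)%N -> s i = s' i) -> (forall i, (i <= k)%N -> t i = t' i) ->
  (s * t) k = (s' * t') k.
Proof.
move=> ss tt /=; apply: eq_bigr => i _.
by rewrite ss ?tt ?leq_subr // -ltnS.
Qed.

Lemma fps_coef_sum (I : finType) (F : I -> fps A) k : (\sum_i F i) k = \sum_i F i k.
Proof. by elim/big_rec2: _ => //= i x y _ ->. Qed.

Lemma fps_expr_small (s : fps A) j k : s 0%N = 0 -> (k < j)%N -> (s ^+ j) k = 0.
Proof.
move=> s0; elim: j k => // j IHj k kj; rewrite exprS /= big_ord_recl s0 mul0r add0r.
rewrite big1 // => i _; rewrite IHj ?mulr0 //= /bump leq0n add1n.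
have := ltn_ord i; lia.
Qed.

(** Up to its constant term, s is 1 - N where N has no constant term, and the
    geometric series in N has coefficients that are finite sums. *)
Lemma fps_invertible (s : fps A) : invertible (s 0%N) -> invertible s.
Proof.
move=> [a [as0 s0a]]; pose N := 1 - fps_const a * s.
have N0 : N 0%N = 0 by rewrite /= big_ord_recl big_ord0 addr0 /= as0 subrr.
pose G : fps A := Fps (fun k => (\sum_(j < k.+1) N ^+ j) k).
have GE i k : (i <= k)%N -> G i = (\sum_(j < k.+1) N ^+ j) i.
  move=> ik; rewrite /G [LHS]/= !fps_coef_sum -!(big_mkord xpredT (fun j => (N ^+ j) i)).
  rewrite [RHS](@big_cat_nat _ _ _ i.+1) //= [X in _ + X]big_nat_cond [X in _ + X]big1 ?addr0 //.
  by move=> j /andP[/andP[ij _] _]; apply: fps_expr_small.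
have iN : invertible (1 - N).
  have sm k : ((1 - N) * \sum_(j < k.+1) N ^+ j) k = (1 : fps A) k.
    rewrite -[1 - N]opprB mulNr -subrX1 opprB /=.
    by rewrite fps_expr_small // oppr0 addr0.
  exists G; split; apply: fpsP => k; last first.
    by rewrite -sm; apply: fps_coefM_eq => // i; apply: GE.
  rewrite -sm (fps_coefM_eq (s' := \sum_(j < k.+1) N ^+ j) (t' := 1 - N)) //.
    congr (fps_coef _ k); apply: commr_sym.
    by apply: commr_sum => i _; apply/commrX/commr_sym/commrB; [exact: commr1|].
  by move=> i; apply: GE.
have -> : s = fps_const (s 0%N) * (1 - N).
  rewrite /N subKr mulrA; have -> : fps_const (s 0%N) * fps_const a = 1.
    apply: fpsP => -[|k]; first by rewrite /= big_ord_recl big_ord0 addr0.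
    rewrite /= big_ord_recl mulr0 add0r big1 // => i _.
    by rewrite mul0r.
  by rewrite mul1r.
apply: (invertibleM _ iN); exists (fps_const a); split; apply: fpsP => -[|k].
- by rewrite /= big_ord_recl big_ord0 addr0.
- by rewrite /= big_ord_recl mulr0 add0r big1 // => i _; rewrite mul0r.
- by rewrite /= big_ord_recl big_ord0 addr0.
- by rewrite /= big_ord_recl mulr0 add0r big1 // => i _; rewrite mul0r.
Qed.

Lemma prod_eq0_seq (I : eqType) (r : seq I) (F : I -> A) i :
  i \in r -> F i = 0 -> \prod_(j <- r) F j = 0.
Proof.
move=> + Fi; elim: r => // j r IHr; rewrite inE big_cons => /orP[/eqP <-|/IHr ->].
  by rewrite Fi mul0r.
by rewrite mulr0.
Qed.

End FpsInvertible.

Section TriangularMatrix.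
Variables (A : nzRingType) (m : nat).
Local Notation n := m.+1.

(** The function rho orders the indices, so that upper and lower triangular
    matrices are treated together. Dividing by the diagonal leaves 1 - N with
    N strictly triangular, hence nilpotent. *)
Lemma invertible_triangular (rho : 'I_n -> nat) (M : 'M[A]_n) :
  (forall i, (rho i < n)%N) -> injective rho ->
  (forall i j, (rho j < rho i)%N -> M i j = 0) ->
  (forall i, invertible (M i i)) -> invertible M.
Proof.
move=> rho_n rho_inj M0 Md.
pose D : 'M[A]_n := diag_mx (\row_i projT1 (boolp.cid (Md i))).
pose D' : 'M[A]_n := diag_mx (\row_i M i i).
have DD' : D * D' = 1.
  rewrite [D * D']mulmx_diag -[RHS]/(1%:M) -diag_const_mx; congr diag_mx; apply/rowP => i.
  by rewrite !mxE; case: (boolp.cid _) => y [].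
have D'D : D' * D = 1.
  rewrite [D' * D]mulmx_diag -[RHS]/(1%:M) -diag_const_mx; congr diag_mx; apply/rowP => i.
  by rewrite !mxE; case: (boolp.cid _) => y [].
pose N := 1 - D * M.
have NE i j : N i j = (i == j)%:R - projT1 (boolp.cid (Md i)) * M i j.
  by rewrite /N [D * M]mul_diag_mx !mxE.
have N0 i j : (rho j <= rho i)%N -> N i j = 0.
  move=> ji; rewrite NE; case: (eqVneq i j) => [<-|ij]; last first.
    by rewrite (M0 i j) ?mulr0 ?subrr // ltn_neqAle ji (inj_eq rho_inj) eq_sym ij.
  by case: (boolp.cid _) => y /= [-> _]; rewrite subrr.
have Nk k i j : (rho j < rho i + k)%N -> (N ^+ k) i j = 0.
  elim: k j => [|k IHk] j ji.
    rewrite expr0 mxE; case: eqP ji => // <-; lia.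
  rewrite exprSr mxE big1 // => p _.
  case: (ltnP (rho p) (rho i + k)) => ip; first by rewrite IHk // mul0r.
  by rewrite N0 ?mulr0 //; lia.
have iN : invertible (1 - N).
  apply: (@invertible_geometric _ _ n); apply/matrixP => i j.
  by rewrite [RHS]mxE Nk //; have := rho_n j; lia.
have -> : M = D' * (1 - N) by rewrite /N subKr mulrA D'D mul1r.
by apply: (invertibleM _ iN); exists D.
Qed.

(** A matrix of series is a series of matrices; this reduces the invertibility
    of the former to that of its constant term. *)
Definition fps_of_mx (M : 'M[fps A]_n) : fps 'M[A]_n :=
  Fps (fun k => map_mx (fun s : fps A => s k) M).
Definition mx_of_fps (s : fps 'M[A]_n) : 'M[fps A]_n :=
  \matrix_(i, j) Fps (fun k => s k i j).

Lemma mx_of_fpsK M : mx_of_fps (fps_of_mx M) = M.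
Proof. by apply/matrixP => i j; rewrite mxE; apply: fpsP => k /=; rewrite mxE. Qed.

Lemma mx_of_fpsM s t : mx_of_fps (s * t) = mx_of_fps s *m mx_of_fps t.
Proof.
apply/matrixP => i j; rewrite !mxE; apply: fpsP => k.
rewrite fps_coef_sum /= summxE.
under [RHS]eq_bigr => p _ do rewrite !mxE /=.
by rewrite exchange_big; apply: eq_bigr => r _ /=; rewrite mxE.
Qed.

Lemma mx_of_fps1 : mx_of_fps 1 = 1%:M.
Proof.
apply/matrixP => i j; rewrite !mxE; apply: fpsP => -[|k] /=.
  by rewrite mxE; case: eqP.
by rewrite mxE; case: eqP.
Qed.

Lemma invertible_mx_fps (M : 'M[fps A]_n) :
  invertible (map_mx (fun s : fps A => s 0%N) M) -> invertible M.
Proof.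
move=> /(@fps_invertible _ (fps_of_mx M))[s [sM Ms]].
exists (mx_of_fps s); split; rewrite -[M]mx_of_fpsK -[_ * _]mx_of_fpsM ?sM ?Ms;
  exact: mx_of_fps1.
Qed.

End TriangularMatrix.

Lemma mxinvP (A : nzRingType) m (M : 'M[A]_m.+1) : invertible M ->
  mxinv M *m M = 1%:M /\ M *m mxinv M = 1%:M.
Proof.
by rewrite /mxinv => iM; case: boolp.pselect => // e; case: (boolp.cid e) => N [].
Qed.

Lemma invertible_unit (A : nzRingType) (s : fps A) :
  invertible s -> s \is a GRing.unit.
Proof. by move=> [t ts]; apply/boolp.asboolP; exists t. Qed.

(** * Entries of the RLL relation *)

Section TensorEntries.
Variables (n : nat).
Local Notation "⟨ i , j ⟩" := (@mxtens_index n n (i, j)).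

Lemma big_mxtens (V : nmodType) (F : 'I_(n * n) -> V) :
  \sum_p F p = \sum_i \sum_j F ⟨i, j⟩.
Proof.
rewrite pair_big /= (reindex (@mxtens_index n n)) /=.
  by apply: eq_bigr => -[].
by exists (@mxtens_unindex n n) => p _; rewrite ?mxtens_indexK ?mxtens_unindexK.
Qed.

Lemma tensmx_lr (B : nzRingType) (X Y : 'M[B]_n) i j k l :
  ((X *t 1%:M) *m (1%:M *t Y)) ⟨i, j⟩ ⟨k, l⟩ = X i k * Y j l.
Proof.
rewrite mxE big_mxtens (bigD1 k) //= [X in _ + X]big1 ?addr0 => [|p pk]; last first.
  by rewrite big1 // => r _; rewrite !tensmxE !mxE (negbTE pk) mul0r mulr0.
rewrite (bigD1 j) //= big1 ?addr0 => [|r rj].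
  by rewrite !tensmxE !mxE !eqxx mulr1 mul1r.
by rewrite !tensmxE !mxE eq_sym (negbTE rj) mulr0 mul0r.
Qed.

Lemma tensmx_rl (B : nzRingType) (X Y : 'M[B]_n) i j k l :
  ((1%:M *t Y) *m (X *t 1%:M)) ⟨i, j⟩ ⟨k, l⟩ = Y j l * X i k.
Proof.
rewrite mxE big_mxtens (bigD1 i) //= [X in _ + X]big1 ?addr0 => [|p pi]; last first.
  by rewrite big1 // => r _; rewrite !tensmxE !mxE eq_sym (negbTE pi) mul0r mul0r.
rewrite (bigD1 l) //= big1 ?addr0 => [|r rl].
  by rewrite !tensmxE !mxE !eqxx mulr1 mul1r.
by rewrite !tensmxE !mxE (negbTE rl) !mulr0.
Qed.

Variables (K : fieldType) (q : K).

(** The defect of the RLL relation. It is kept as a function of an arbitrary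
    matrix M because the argument that cancels the scalar factor of the
    R-matrix uses its linearity in M. *)
Definition Rcomm (B : algType K) (M : 'M[K]_(n * n)) (X Y : 'M[B]_n) :=
  map_mx (in_alg B) M *m (X *t 1%:M) *m (1%:M *t Y)
  - (1%:M *t Y) *m (X *t 1%:M) *m map_mx (in_alg B) M.

Definition Rshape (M : 'M[K]_(n * n)) (a b : 'I_n -> 'I_n -> K) :=
  forall i j k l, M ⟨i, j⟩ ⟨k, l⟩ =
    a i j *+ ((i == k) && (j == l)) + b i j *+ ((i == l) && (j == k)).

Lemma sum_Rshapel (B : algType K) a b (i j : 'I_n) (Z : 'I_n -> 'I_n -> B) :
  \sum_k \sum_l (a i j *+ ((i == k) && (j == l)) + b i j *+ ((i == l) && (j == k)) : K) *: Z k l =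
  a i j *: Z i j + b i j *: Z j i.
Proof.
under eq_bigr => k _ do under eq_bigr => l _ do rewrite scalerDl.
under eq_bigr => k _ do rewrite big_split.
rewrite big_split /=; congr (_ + _).
  rewrite (bigD1 i) //= [X in _ + X]big1 ?addr0 => [|k ki]; last first.
    by rewrite big1 // => l _; rewrite eq_sym (negbTE ki) mulr0n scale0r.
  rewrite (bigD1 j) //= big1 ?addr0 ?eqxx //= => l lj.
  by rewrite (eq_sym j) (negbTE lj) mulr0n scale0r.
rewrite (bigD1 j) //= [X in _ + X]big1 ?addr0 => [|k kj]; last first.
  by rewrite big1 // => l _; rewrite (eq_sym j) (negbTE kj) andbF mulr0n scale0r.
rewrite (bigD1 i) //= big1 ?addr0 ?eqxx //= => l li.
by rewrite (eq_sym i) (negbTE li) mulr0n scale0r.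
Qed.

Lemma sum_Rshaper (B : algType K) a b (k l : 'I_n) (Z : 'I_n -> 'I_n -> B) :
  \sum_i \sum_j (a i j *+ ((i == k) && (j == l)) + b i j *+ ((i == l) && (j == k)) : K) *: Z i j =
  a k l *: Z k l + b l k *: Z l k.
Proof.
under eq_bigr => i _ do under eq_bigr => j _ do rewrite scalerDl.
under eq_bigr => i _ do rewrite big_split.
rewrite big_split /=; congr (_ + _).
  rewrite (bigD1 k) //= [X in _ + X]big1 ?addr0 => [|i ik]; last first.
    by rewrite big1 // => j _; rewrite (negbTE ik) mulr0n scale0r.
  rewrite (bigD1 l) //= big1 ?addr0 ?eqxx //= => j jl.
  by rewrite (negbTE jl) mulr0n scale0r.
rewrite (bigD1 l) //= [X in _ + X]big1 ?addr0 => [|i il]; last first.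
  by rewrite big1 // => j _; rewrite (negbTE il) mulr0n scale0r.
rewrite (bigD1 k) //= big1 ?addr0 ?eqxx //= => j jk.
by rewrite (negbTE jk) mulr0n scale0r.
Qed.

Lemma Rcomm_entry (B : algType K) M a b (X Y : 'M[B]_n) i j k l :
  Rshape M a b -> Rcomm M X Y ⟨i, j⟩ ⟨k, l⟩ =
    a i j *: (X i k * Y j l) + b i j *: (X j k * Y i l)
    - (a k l *: (Y j l * X i k) + b l k *: (Y j k * X i l)).
Proof.
move=> Mab; rewrite /Rcomm -mulmxA 3!mxE; congr (_ - _).
  rewrite big_mxtens -(sum_Rshapel a b i j (fun i' j' => X i' k * Y j' l)).
  apply: eq_bigr => p _; apply: eq_bigr => r _.
  by rewrite tensmx_lr mxE Mab mulr_algl.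
rewrite mxE big_mxtens -(sum_Rshaper a b k l (fun k' l' => Y j l' * X i k')).
apply: eq_bigr => p _; apply: eq_bigr => r _.
by rewrite tensmx_rl mxE Mab mulr_algr.
Qed.

Lemma RcommD (B : algType K) M M' (X Y : 'M[B]_n) :
  Rcomm (M + M') X Y = Rcomm M X Y + Rcomm M' X Y.
Proof. by rewrite /Rcomm map_mxD !mulmxDl mulmxDr opprD addrACA. Qed.

Lemma Rcomm0l (B : algType K) M (Y : 'M[B]_n) : Rcomm M 0 Y = 0.
Proof. by rewrite /Rcomm tens0mx !(mulmx0, mul0mx) subrr. Qed.
Lemma Rcomm0r (B : algType K) M (X : 'M[B]_n) : Rcomm M X 0 = 0.
Proof. by rewrite /Rcomm tensmx0 !(mulmx0, mul0mx) subrr. Qed.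
Lemma map_mx_in_algZ (B : algType K) (c : K) (M : 'M[K]_(n * n)) :
  map_mx (in_alg B) (c *: M) = c%:A *: map_mx (in_alg B) M.
Proof. by apply/matrixP => i j; rewrite !mxE rmorphM. Qed.

Lemma mulmx_algZ (B : algType K) p (c : K) (M N : 'M[B]_p) :
  N *m (c%:A *: M) = c%:A *: (N *m M).
Proof.
apply/matrixP => i j; rewrite !mxE mulr_sumr; apply: eq_bigr => k _.
by rewrite mxE !mulr_algl scalerAr.
Qed.

Lemma RcommZ (B : algType K) c M (X Y : 'M[B]_n) :
  Rcomm (c *: M) X Y = c%:A *: Rcomm M X Y.
Proof.
by rewrite /Rcomm map_mx_in_algZ mulmx_algZ -!scalemxAl scalerBr.
Qed.

Lemma Rcomm_linear (B : algType K) (X Y : 'M[B]_n) p r :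
  linear (fun M : 'M[K]_(n * n) => Rcomm M X Y p r).
Proof.
move=> c M M'; rewrite RcommD RcommZ.
by move: (Rcomm M X Y) (Rcomm M' X Y) => Z Z'; rewrite !mxE mulr_algl.
Qed.

Definition Rt_diag (i j : 'I_n) : K := if i == j then q^-1 else 1.
Definition Rt_swap (i j : 'I_n) : K :=
  if i == j then 0 else if (i < j)%N then 0 else - (q - q^-1).

Lemma sum_pick (P : rel 'I_n) (F : 'I_n -> 'I_n -> K) (i j : 'I_n) :
  (forall a b, (a != i) || (b != j) -> F a b = 0) ->
  \sum_a \sum_(b | P a b) F a b = F i j *+ P i j.
Proof.
move=> F0; rewrite (bigD1 i) //= [X in _ + X]big1 ?addr0 => [|a ai]; last first.
  by rewrite big1 // => b _; rewrite F0 ?ai.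
rewrite big_mkcond (bigD1 j) //= big1 ?addr0 => [|b bj]; last first.
  by rewrite F0 ?bj ?orbT // if_same.
by case: (P i j).
Qed.

Lemma sum_delta_diag (P : rel 'I_n) i j k l :
  (\sum_(a < n) \sum_(b < n | P a b) delta_mx a a *t delta_mx b b) ⟨i, j⟩ ⟨k, l⟩ =
  (P i j)%:R *+ ((i == k) && (j == l)) :> K.
Proof.
rewrite summxE; under eq_bigr => a _ do rewrite summxE.
rewrite (@sum_pick _ _ i j) => [|a b ab]; rewrite tensmxE !mxE ?eqxx.
  rewrite (eq_sym k) (eq_sym l) /=.
  by case: (i == k); case: (j == l); case: (P i j);
    rewrite /= ?(mulr1, mul1r, mulr0, mul0r, mul0rn).
by move: ab; rewrite (eq_sym i) (eq_sym j) => /orP[]/negbTE->; rewrite ?mul0r ?mulr0.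
Qed.

Lemma sum_delta_swap (P : rel 'I_n) i j k l :
  (\sum_(a < n) \sum_(b < n | P a b) delta_mx a b *t delta_mx b a) ⟨i, j⟩ ⟨k, l⟩ =
  (P i j)%:R *+ ((i == l) && (j == k)) :> K.
Proof.
rewrite summxE; under eq_bigr => a _ do rewrite summxE.
rewrite (@sum_pick _ _ i j) => [|a b ab]; rewrite tensmxE !mxE ?eqxx.
  rewrite (eq_sym k) (eq_sym l) /=.
  by case: (i == l); case: (j == k); case: (P i j);
    rewrite /= ?(mulr1, mul1r, mulr0, mul0r, mul0rn).
by move: ab; rewrite (eq_sym i) (eq_sym j) => /orP[]/negbTE->; rewrite ?mul0r ?mulr0.
Qed.

Lemma Rmat_shape : Rshape (Rmat n q) (Rdiag q 0) (Rswap q 0).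
Proof.
move=> i j k l; rewrite /Rmat /Rdiag /Rswap.
have -> : \sum_(i < n) delta_mx i i *t delta_mx i i =
   \sum_(i < n) \sum_(j < n | i == j) delta_mx i i *t delta_mx j j :> 'M[K]_(n * n).
  by apply: eq_bigr => a _; rewrite (big_pred1 a) // => b; rewrite eq_sym.
rewrite !mxE sum_delta_diag sum_delta_diag sum_delta_swap.
case: ltnP; case: eqVneq => [<-|ij]; rewrite ?ltnn //= => _;
case: (_ && _); case: (_ && _); rewrite ?mulr1n ?mulr0n; ring.
Qed.

Lemma Rtmat_shape : Rshape (Rtmat n q) Rt_diag Rt_swap.
Proof.
move=> i j k l; rewrite /Rtmat /Rt_diag /Rt_swap.
have -> : \sum_(i < n) delta_mx i i *t delta_mx i i =
   \sum_(i < n) \sum_(j < n | i == j) delta_mx i i *t delta_mx j j :> 'M[K]_(n * n).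
  by apply: eq_bigr => a _; rewrite (big_pred1 a) // => b; rewrite eq_sym.
rewrite !mxE sum_delta_diag sum_delta_diag (sum_delta_swap (fun a b => b < a)%N).
case: (ltngtP i j) => [ij|ij|/ord_inj <-]; rewrite ?ltnn ?eqxx //=.
all: try rewrite -(inj_eq (@ord_inj n)) ?(ltn_eqF ij) ?(gtn_eqF ij).
all: case: (_ && _); case: (_ && _); rewrite ?mulr1n ?mulr0n //=; ring.
Qed.

End TensorEntries.

(** * Cancelling the scalar factor of the R-matrix *)

Lemma sum_trunc (V : nmodType) p p' (F : nat -> V) :
  (forall k, (p <= k)%N -> F k = 0) -> (forall k, (p' <= k)%N -> F k = 0) ->
  \sum_(k < p) F k = \sum_(k < p') F k.
Proof.
wlog pp' : p p' / (p <= p')%N.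
  by move=> W Fp Fp'; case/orP: (leq_total p p') => ?; [|symmetry]; apply: W.
move=> Fp _; rewrite (big_ord_widen p' F pp') big_mkcond /=.
by apply: eq_bigr => k _; case: ltnP => // /Fp.
Qed.

Lemma sum_triangle (V : nmodType) N (F : nat -> nat -> V) :
  \sum_(t < N) \sum_(m < t.+1) F m (t - m)%N =
  \sum_(m < N) \sum_(k < N - m) F m k.
Proof.
elim: N => [|N IHN]; first by rewrite !big_ord0.
rewrite big_ord_recr IHN /= big_ord_recr [RHS]big_ord_recr /= addrA.
congr (_ + _); last by rewrite subSn // subnn big_ord1.
rewrite -big_split; apply: eq_bigr => m _ /=.
by rewrite subSn ?big_ord_recr // ltnW.
Qed.

Lemma linear_rules (K : pzRingType) (U V : lmodType K) (g : U -> V) : linear g ->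
  [/\ g 0 = 0, forall u, g (- u) = - g u &
      (forall c u, g (c *: u) = c *: g u) /\
      (forall (I : finType) (F : I -> U), g (\sum_i F i) = \sum_i g (F i))].
Proof.
move=> gL.
pose h : {linear U -> V} := HB.pack g (GRing.isLinear.Build _ _ _ _ _ gL).
split; [exact: (raddf0 h) | exact: (raddfN h) | split].
  exact: (linearZZ h).
by move=> I F; exact: (linear_sum h).
Qed.

(** Summing the hypotheses for m with weights H m and collecting the terms with
    the same t = m + k produces the convolution of H with R. *)
Lemma cancel_series (K : fieldType) (V : lmodType K) (U : lmodType K) N
    (H : nat -> K) (R S : nat -> U) (ev : nat -> U -> V) :
  (forall t, linear (ev t)) ->
  (forall j, S j = \sum_(m < j.+1) H m *: R (j - m)%N) ->
  (forall m, (m < N)%N -> \sum_(k < N - m) ev (m + k)%N (R k) = 0) ->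
  \sum_(t < N) ev t (S t) = 0.
Proof.
move=> evL SE evR.
transitivity (\sum_(t < N) \sum_(m < t.+1) H m *: ev (m + (t - m))%N (R (t - m)%N)).
  apply: eq_bigr => t _; have [_ _ [evZ evS]] := linear_rules (evL t).
  rewrite SE evS; apply: eq_bigr => m _ /=.
  by rewrite evZ subnKC // -ltnS.
rewrite (sum_triangle _ (fun m k => H m *: ev (m + k)%N (R k))).
by rewrite big1 // => m _; rewrite -scaler_sumr evR // scaler0.
Qed.

Lemma tsideal_genP (K : comNzRingType) (F : algType K) (S : F -> Prop) H x :
  S x -> tsideal_gen (S := S) H x.
Proof.
by move=> Sx; rewrite /tsideal_gen; case: ideal_gen_closed => /= *; move=> J _; apply.
Qed.

Lemma Rcomm_map (K : fieldType) (n : nat) (F B : algType K)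
    (phi : {lrmorphism F -> B}) (M : 'M[K]_(n * n)) (X Y : 'M[F]_n) k :
  map_mx phi ((1 ^+ k *: map_mx (fun c : K => c%:A) M) *m (X *t 1%:M) *m (1%:M *t Y)
    - (1%:M *t Y) *m (X *t 1%:M) *m (1 ^+ k *: map_mx (fun c : K => c%:A) M)) =
  Rcomm M (map_mx phi X) (map_mx phi Y).
Proof.
rewrite expr1n !scale1r map_mxB !map_mxM !map_mxT !map_mx1 /Rcomm /=.
have -> // : map_mx phi (map_mx (fun c : K => c%:A) M) = map_mx (in_alg B) M.
by apply/matrixP => i j; rewrite !mxE /= linearZ rmorph1.
Qed.

Section Cancellation.
Variables (K : fieldType) (n : nat) (q : K) (f : fps K).
Hypotheses (q_neq0 : q != 0) (f0 : f 0%N = 1).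

(** H is the inverse of the series f(x) / (q - q^-1 x), and multiplying R(x) by
    it leaves R - x R~. *)
Lemma Rser_cancel : exists H : fps K, forall j,
  \sum_(m < j.+1) H m *: Rcoef n q f (j - m) =
  match j with 0 => Rmat n q | 1 => - Rtmat n q | _ => 0 end.
Proof.
pose D : fps K := fps_const q - fps_const q^-1 * fpsX.
have D0 : D 0%N = q by rewrite /= big_ord_recl big_ord0 /= mulr0 addr0 subr0.
have iD : invertible D.
  by apply: fps_invertible; rewrite D0; exists q^-1; rewrite mulVf ?mulfV.
have [f' [f'f _]] : invertible f.
  by apply: fps_invertible; rewrite f0; apply: invertible1.
have uD := invertible_unit iD.
exists (D * f') => j; apply/matrixP => p r.
have -> : (\sum_(m < j.+1) (D * f') m *: Rcoef n q f (j - m)) p r =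
    ((D * f') * Rser n q f p r) j.
  by rewrite summxE /=; apply: eq_bigr => m _; rewrite !mxE.
rewrite /Rser; move: (Rmat n q) (Rtmat n q) => M0 M1; rewrite mxE.
rewrite mulrA -(mulrA D) (mulrA f') f'f mul1r mulrV // mul1r !mxE.
case: j => [|[|j]] /=.
- by rewrite big_ord_recl big_ord0 /= mul0r addr0 subr0.
- by rewrite !big_ord_recl big_ord0 /= mul0r mul1r !addr0 !add0r !mxE.
- rewrite sub0r mxE big1 ?oppr0 // => -[[|[|i]] ij] _ /=; rewrite ?mul0r //.
  by rewrite mulr0.
Qed.

(** The relations at (a - m, b + m), weighted by H m and summed over m, add up
    to the relation for R - x R~, which has only two terms. All the sums are
    finite because L vanishes far away in one of the two directions. *)
Lemma Rcomm_cancel (B : algType K) (L : int -> 'M[B]_n) :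
  (forall a b, \sum_(k < (`|a| + `|b|).+1)
     Rcomm (Rcoef n q f k) (L (a - k%:Z)) (L (b + k%:Z)) = 0) ->
  (forall a b (k : nat), (`|a| + `|b| < k)%N -> L (a - k%:Z) = 0 \/ L (b + k%:Z) = 0) ->
  forall a b, Rcomm (Rmat n q) (L a) (L b) = Rcomm (Rtmat n q) (L (a - 1)) (L (b + 1)).
Proof.
move=> RLL L0 a b; have [H HR] := Rser_cancel.
apply/matrixP => p r.
pose e M X Y : B := Rcomm M X Y p r.
have e0 M X Y : X = 0 \/ Y = 0 -> e M X Y = 0.
  by rewrite /e => -[] ->; rewrite ?Rcomm0l ?Rcomm0r mxE.
have eRLL a' b' : \sum_(k < (`|a'| + `|b'|).+1)
     e (Rcoef n q f k) (L (a' - k%:Z)) (L (b' + k%:Z)) = 0.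
  by have /(congr1 (fun M : 'M[B]_(n * n) => M p r)) := RLL a' b'; rewrite summxE [RHS]mxE.
have eL X Y : linear (fun M => e M X Y) by exact: Rcomm_linear.
rewrite -/(e _ _ _) -/(e _ _ _); move: e e0 eRLL eL => e e0 eRLL eL.
pose ev t M := e M (L (a - t%:Z)) (L (b + t%:Z)).
pose N := (`|a| + `|b|).+1.
have ev_small t M : (N <= t)%N -> ev t M = 0 by move=> /L0; apply: e0.
have evR m : (m < N.+1)%N -> \sum_(k < N.+1 - m) ev (m + k)%N (Rcoef n q f k) = 0.
  move=> mN; rewrite -[RHS](eRLL (a - m%:Z) (b + m%:Z)).
  have evE k : ev (m + k)%N (Rcoef n q f k) =
      e (Rcoef n q f k) (L (a - m%:Z - k%:Z)) (L (b + m%:Z + k%:Z)).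
    by rewrite /ev; congr (e _ (L _) (L _)); lia.
  under eq_bigr => k _ do rewrite evE.
  apply: (sum_trunc (F := fun k => e (Rcoef n q f k)
    (L (a - m%:Z - k%:Z)) (L (b + m%:Z + k%:Z)))) => k hk.
    by rewrite -evE ev_small //; lia.
  by apply: e0; apply: L0.
have evL t : linear (ev t) by apply: eL.
have := cancel_series evL (fun j => esym (HR j)) evR.
rewrite 2!big_ord_recl /= big1 => [|i _]; last first.
  by have [] := linear_rules (evL i.+2).
have [_ -> _] := linear_rules (evL 1%N).
rewrite addr0 => /eqP; rewrite subr_eq0 => /eqP.
by rewrite /ev subr0 addr0.
Qed.

Local Notation U := (Uq n q f).
Local Notation pi := (quot_pi (tsideal_gen (@uq_ideal_proper K n q f))).

Lemma uq_relator0 x : uq_relator q f x -> pi x = 0.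
Proof.
by move=> rx; rewrite -(rmorph0 pi); apply/quot_piP; rewrite subr0; apply: tsideal_genP.
Qed.

(** L(u) indexed by all integral powers of u. *)
Definition Lint (s : sgn) (a : int) : 'M[U]_n := map_mx pi (Lcoef K n s a).

Lemma Lint_RLL s a b :
  \sum_(k < (`|a| + `|b|).+1)
    Rcomm (Rcoef n q f k) (Lint s (a - k%:Z)) (Lint s (b + k%:Z)) = 0.
Proof.
transitivity (map_mx pi (RLLrel q f s s 1 1 a b)).
  by rewrite map_mx_sum; apply: eq_bigr => k _; rewrite -(Rcomm_map pi _ _ _ k).
apply/matrixP => i j; rewrite !mxE; apply: uq_relator0; exact: RelRLLsame.
Qed.

Lemma Lint_small s a b (k : nat) : (`|a| + `|b| < k)%N ->
  Lint s (a - k%:Z) = 0 \/ Lint s (b + k%:Z) = 0.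
Proof.
move=> abk; case: s; [left|right]; apply/matrixP => i j; rewrite !mxE.
  have -> : a - k%:Z = Negz (`|a - k%:Z|).-1 by lia.
  exact: rmorph0.
have -> : b + k%:Z = Posz (`|b + k%:Z|).-1.+1 by lia.
exact: rmorph0.
Qed.

End Cancellation.

(** * From coefficients to series *)

Section FpsExchange.
Variables (K : fieldType) (n : nat) (q : K) (A : algType K) (s : sgn).
Local Notation "⟨ i , j ⟩" := (@mxtens_index n n (i, j)).
Implicit Types (L : nat -> 'M[A]_n) (c x : K).

(** Replacing u by c u dilates a series in u^-1 by c^-1. *)
Definition param (s : sgn) (c : K) : K := if s is Plus then c else c^-1.

Definition coef_int L (a : int) : 'M[A]_n :=
  match s, a with
  | Plus, Posz r => L r
  | Plus, Negz _ => 0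
  | Minus, Posz 0 => L 0%N
  | Minus, Posz _.+1 => 0
  | Minus, Negz r => L r.+1
  end.

Lemma fps_coefM_flip (t u : fps A) w :
  (t * u) w = \sum_(r < w.+1) t (w - r)%N * u r.
Proof.
rewrite /= (reindex_inj rev_ord_inj) /=; apply: eq_bigr => r _.
by rewrite subSS subKn // -ltnS.
Qed.

(** In the coefficient of degree w, the term of R in one place cancels that of
    x R~ in a neighbouring place. The term left over at each end vanishes,
    being related to a coefficient of L with an index of the wrong sign. *)
Lemma exchange_of_Rcomm L :
  (forall a b, Rcomm (Rmat n q) (coef_int L a) (coef_int L b) =
     Rcomm (Rtmat n q) (coef_int L (a - 1)) (coef_int L (b + 1))) ->
  forall x c, x != 0 ->
  exchange q x (fun i j => fps_dil (param s (x * c)) (Fps (fun r => L r i j)))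
    (fun i j => fps_dil (param s c) (Fps (fun r => L r i j))).
Proof.
move=> RLL x c x0 i j k l.
pose E0 r r' := Rcomm (Rmat n q) (L r) (L r') ⟨i, j⟩ ⟨k, l⟩.
pose E1 r r' := Rcomm (Rtmat n q) (L r) (L r') ⟨i, j⟩ ⟨k, l⟩.
have Rdiag_x a b : Rdiag q x a b = Rdiag q 0 a b - x * Rt_diag q a b.
  by rewrite /Rdiag /Rt_diag; case: eqP => _; ring.
have Rswap_x a b : Rswap q x a b = Rswap q 0 a b - x * Rt_swap q a b.
  by rewrite /Rswap /Rt_swap; case: (a == b); case: (a < b)%N; ring.
have EE r r' : E0 r r' - x *: E1 r r' =
  Rdiag q x i j *: (L r i k * L r' j l) + Rswap q x i j *: (L r j k * L r' i l)
  - (Rdiag q x k l *: (L r' j l * L r i k) + Rswap q x l k *: (L r' j k * L r i l)).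
  have distr (p p' u u' v v' w w' : A) :
      p - p' + (u - u') - (v - v' + (w - w')) =
      p + u - (v + w) - (p' + u' - (v' + w')).
    rewrite (addrACA p) (addrACA v) -!opprD !opprB.
    by rewrite addrACA [RHS]addrACA; congr (_ + _); rewrite addrC.
  rewrite /E0 /E1 (@Rcomm_entry n K A _ _ _ (L r) (L r') i j k l (Rmat_shape q)).
  rewrite (@Rcomm_entry n K A _ _ _ (L r) (L r') i j k l (Rtmat_shape q)) !Rdiag_x !Rswap_x.
  by rewrite !scalerBl distr -!scalerA -!scalerDr -scalerBr.
have rel : match s with
    | Plus => [/\ forall r, E0 0%N r = 0, forall r, E1 r 0%N = 0 &
                forall r r', E0 r.+1 r' = E1 r r'.+1]
    | Minus => [/\ forall r, E0 r 0%N = 0, forall r, E1 0%N r = 0 &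
                forall r r', E0 r r'.+1 = E1 r.+1 r']
    end.
  move: (fun a b => congr1 (fun M : 'M[A]_(n * n) => M ⟨i, j⟩ ⟨k, l⟩) (RLL a b)).
  rewrite /E0 /E1 /coef_int; case: s => e; split=> [r|r|r r'].
  - by have := e 0 (Posz r); rewrite Rcomm0l [RHS]mxE.
  - have := e (Posz r.+1) (-1); rewrite Rcomm0r [LHS]mxE.
    by have -> : Posz r.+1 - 1 = r by lia.
  - have := e (Posz r.+1) (Posz r').
    have -> : Posz r.+1 - 1 = Posz r by lia.
    by have -> : Posz r' + 1 = Posz r'.+1 by lia.
  - have := e (- Posz r) 0; rewrite Rcomm0r [RHS]mxE.
    by case: r => [|r].
  - have := e 1 (Negz r); rewrite Rcomm0l [LHS]mxE => /esym.
    have -> : 1 - 1 = 0 :> int by []. 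
    have -> : Negz r + 1 = - Posz r by lia.
    by case: r => [|r].
  - have := e (- Posz r) (Negz r').
    have -> : - Posz r - 1 = Negz r by lia.
    have -> : Negz r' + 1 = - Posz r' by lia.
    by case: r r' => [|r] [|r'].
clearbody E0 E1 => {RLL}.
apply/eqP; rewrite -subr_eq0; apply/eqP/fpsP => w.
transitivity (\sum_(r < w.+1)
    (param s (x * c) ^+ r * param s c ^+ (w - r)) *: (E0 r (w - r)%N - x *: E1 r (w - r)%N)).
  have coefB (t u : fps A) : (t - u) w = t w - u w by [].
  have coefD (t u : fps A) : (t + u) w = t w + u w by [].
  have coefZ a (t : fps A) : (a *: t) w = a *: t w by [].
  have coefM (t u : fps A) : (t * u) w = \sum_(r < w.+1) t r * u (w - r)%N by [].
  rewrite coefB !coefD !coefZ ![(fps_dil (param s c) _ * _) w]fps_coefM_flip !coefM.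
  rewrite !scaler_sumr -!big_split -sumrB; apply: eq_bigr => r _.
  rewrite EE /= -!scalerAl -!scalerAr !scalerA scalerBr !scalerDr !scalerA.
  by congr (_ *: _ + _ *: _ - (_ *: _ + _ *: _)); ring.
rewrite (_ : (\sum_(r < w.+1) _) = param s c ^+ w *:
    (\sum_(r < w.+1) param s x ^+ r *: E0 r (w - r)%N -
     \sum_(r < w.+1) (param s x ^+ r * x) *: E1 r (w - r)%N)); last first.
  rewrite -sumrB scaler_sumr; apply: eq_bigr => r _.
  have -> : param s (x * c) = param s x * param s c.
    by rewrite /param; case: s; rewrite ?invfM.
  rewrite exprMn -mulrA -exprD subnKC; last by rewrite -ltnS.
  by rewrite mulrC -[LHS]scalerA [_ *: (E0 _ _ - _)]scalerBr scalerA.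
suff -> : \sum_(r < w.+1) param s x ^+ r *: E0 r (w - r)%N =
     \sum_(r < w.+1) (param s x ^+ r * x) *: E1 r (w - r)%N by rewrite subrr scaler0.
move: rel; rewrite /param; case: s => -[e0 e1 e01].
  rewrite big_ord_recl e0 scaler0 add0r [RHS]big_ord_recr /= subnn e1 scaler0 addr0.
  apply: eq_bigr => r _; rewrite /= /bump /= add1n exprSr e01.
  by congr (_ *: E1 _ _); have := ltn_ord r; lia.
rewrite big_ord_recr /= subnn e0 scaler0 addr0 [RHS]big_ord_recl e1 scaler0 add0r.
apply: eq_bigr => r _; rewrite /= /bump /= add1n.
have -> : (w - r = (w - r.+1).+1)%N by have := ltn_ord r; lia.
by rewrite e01 exprSr -mulrA mulVf // mulr1.
Qed.
End FpsExchange.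

(** * The ratio of quantum determinants *)

Section QdetRatio.
Variables (K : fieldType) (q : K) (m : nat) (A : algType K) (s : sgn).
Local Notation n := m.+1.
Hypotheses (q_neq0 : q != 0) (q_nroot : forall k, (0 < k)%N -> q ^+ k != 1).
Variable L : 'M[fps A]_n.

Definition dil_entries c : 'I_n -> 'I_n -> fps A :=
  fun i j => fps_dil (param s c) (L i j).

Hypothesis L_exchange : forall x c, x != 0 ->
  exchange q x (dil_entries (x * c)) (dil_entries c).
Hypothesis L_inv : invertible L.
Hypothesis d_inv : invertible (qdet q s L).

(** The columns of the quantum determinant, from left to right. *)
Let T k := dil_entries (q ^+ (2 * m) * q ^- (2 * k)).
Let d := contr T (fun u => (eps q u)%:A) (enum 'I_n).

Let paramM (a b : K) : param s (a * b) = param s a * param s b.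
Proof. by rewrite /param; case: s; rewrite ?invfM. Qed.

Let dil1 i j : dil_entries 1 i j = L i j.
Proof.
have -> : dil_entries 1 i j = fps_dil 1 (L i j).
  by rewrite /dil_entries /param; case: s; rewrite ?invr1.
exact: fps_dil1.
Qed.

Lemma qdet_contr : qdet q s L = d.
Proof.
rewrite /d contr_enum; apply: eq_bigr => p _.
rewrite -mulr_algl /fps_scal fps_algE; congr (_ * _); apply: eq_bigr => i _.
rewrite /qshift /T /dil_entries; congr fps_dil; rewrite /param.
have -> : (2 * n - 2 - 2 * i = 2 * m - 2 * i)%N by lia.
have im : (2 * i <= 2 * m)%N by rewrite leq_mul2l /= -ltnS.
by case: s; rewrite exprB // unitfE.
Qed.

Lemma shift_qpair k : qpair q (T k) (T k.+1).
Proof.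
apply: exchange_qpair; [by [] | exact: q_nroot | ].
have := @L_exchange (q ^+ 2) (q ^+ (2 * m) * q ^- (2 * k.+1)) (expf_neq0 _ q_neq0).
suff -> : q ^+ 2 * (q ^+ (2 * m) * q ^- (2 * k.+1)) = q ^+ (2 * m) * q ^- (2 * k) by [].
by rewrite mulnS exprD; field; rewrite expf_neq0.
Qed.

(** Here X k is the spectral ratio of T k against L itself, and none of the
    factors of Rtheta vanishes because q is not a root of unity. *)
Lemma qdet_comm i j : d * L i j = L i j * d.
Proof.
pose X k := q ^+ (2 * m) * q ^- (2 * k).
apply: (@contr_exchange_comm K q m (fps A) q_neq0 T L X).
- by move=> k; rewrite /X mulnS exprD; field; rewrite expf_neq0.
- rewrite /Rtheta /X mulf_neq0 //.
    apply/prodf_neq0 => k _; rewrite subr_eq0 eq_sym -exprB ?unitfE //; last first.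
      by rewrite leq_mul2l ltnW.
    by apply: q_nroot; rewrite subn_gt0 ltn_mul2l ltn_ord.
  rewrite mulfV ?expf_neq0 // mulr1 subr_eq0; apply/eqP => qE.
  have /eqP[] : q ^+ 2 != 1 by exact: q_nroot.
  by rewrite expr2 {1}qE mulVf.
- exact: shift_qpair.
- move=> k a b a' b'.
  have Xk0 : X k != 0 by rewrite mulf_neq0 ?invr_eq0 ?expf_neq0.
  by have := @L_exchange (X k) 1 Xk0 a b a' b'; rewrite mulr1 !dil1.
Qed.

Let w1 : seq 'I_n := behead (enum 'I_n).

Let enumE : enum 'I_n = ord0 :: w1.
Proof. by rewrite /w1 enum_ordSl. Qed.

Let size_w1 : size w1 = m.
Proof. by rewrite /w1 size_behead size_enum_ord. Qed.

(** Up to a scalar, the entry (0, k) of the quantum comatrix of L(q^2 u). *)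
Let C k := contr T (fun u => (eps q (rcons u k))%:A) w1.

Let N := mxinv L.

Lemma contr_eps w : size w = n -> contr T (fun u => (eps q u)%:A) w = eps q w *: d.
Proof.
by move=> sw; rewrite (qalt_epsE (contr_qalt shift_qpair (eps_alg_qalt _ _)) sw).
Qed.

(** The word 1, ..., m, b has a repeated letter unless b = 0. So expanding its
    contraction along the last column, which consists of entries of L itself,
    shows that the row C times L is a multiple of qdet L(u) times the first
    unit row. *)
Lemma last_column_expansion k : C k = (- q) ^- m *: (d * N ord0 k).
Proof.
have [_ LN] := mxinvP L_inv.
have e0 : eps q (rcons w1 ord0) = (- q) ^- m.
  have : eps q (ord0 :: w1) = 1 by rewrite -enumE eps_sorted // sorted_enum_ord.
  rewrite eps_rotate // muln0 expr0 invr1 mulr1 => e.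
  have qm0 : (- q) ^+ m != 0 by rewrite expf_neq0 // oppr_eq0.
  by apply: (mulfI qm0); rewrite e mulfV.
have CL b : \sum_k C k * L k b = ((- q) ^- m *: d) *+ (b == ord0).
  transitivity (contr T (fun u => (eps q u)%:A) (rcons w1 b)).
    rewrite contr_rcons => [|k' a b' u]; last by rewrite mulr_algl mulr_algr.
    apply: eq_bigr => k' _; rewrite size_w1; congr (_ * _).
    by rewrite /T mulfV ?expf_neq0 // dil1.
  rewrite contr_eps ?size_rcons ?size_w1 //; case: eqP => [->|/eqP b0].
    by rewrite e0.
  suff -> : eps q (rcons w1 b) = 0 by rewrite scale0r.
  rewrite /eps rcons_uniq; suff -> : b \in w1 by [].
  by have := mem_enum 'I_n b; rewrite enumE !inE (negbTE b0).
have -> : C k = \sum_b (\sum_k' C k' * L k' b) * N b k.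
  under eq_bigr => b _ do rewrite mulr_suml.
  rewrite exchange_big /=.
  under eq_bigr => k' _ do under eq_bigr => b _ do rewrite -mulrA.
  under eq_bigr => k' _ do rewrite -mulr_sumr.
  have LNE k' : \sum_b L k' b * N b k = (k' == k)%:R.
    by have /matrixP/(_ k' k) := LN; rewrite !mxE.
  transitivity (\sum_k' C k' * (k' == k)%:R).
    rewrite (bigD1 k) //= big1 ?addr0 => [|k' kk]; first by rewrite eqxx mulr1.
    by rewrite (negbTE kk) mulr0.
  by apply: eq_bigr => k' _; congr (_ * _); apply: esym; apply: LNE.
transitivity (\sum_b (((- q) ^- m *: d) *+ (b == ord0)) * N b k).
  by apply: eq_bigr => b _; congr (_ * _); apply: CL.
rewrite (bigD1 ord0) //= big1 ?addr0 => [|b /negbTE ->].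
  by rewrite scalerAl.
by rewrite mulr0n mul0r.
Qed.

Lemma qdet_comm_inv k : d * N ord0 k = N ord0 k * d.
Proof.
have [NL LN] := mxinvP L_inv.
have dL : d%:M *m L = L *m d%:M.
  by apply/matrixP => i j; rewrite mulmx_scalarE mul_scalar_mx mxE qdet_comm.
have dN : d%:M *m N = N *m d%:M.
  by rewrite -[LHS]mul1mx -NL -!mulmxA (mulmxA L) -dL -(mulmxA d%:M) LN mulmx1.
have := congr1 (fun M : 'M[fps A]_n => M ord0 k) dN.
by rewrite mulmx_scalarE mul_scalar_mx mxE.
Qed.

(** Replacing u by q^2 u shifts the family T by one place. So in the expansion
    of qdet L(q^2 u) along its first column, the remaining factors are the ones
    that define C. *)
Lemma first_column_expansion : fps_dil (param s (q ^+ 2)) d =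
  \sum_(k < n) q ^- (2 * k) *: (dil_entries (q ^+ (2 * n)) k ord0 * N ord0 k) * d.
Proof.
pose phi : {rmorphism fps A -> fps A} := fps_dil (param s (q ^+ 2)).
have TS k i j : phi (T k.+1 i j) = T k i j.
  rewrite /phi /T /dil_entries [LHS]fps_dilM -paramM.
  suff -> : q ^+ 2 * (q ^+ (2 * m) * q ^- (2 * k.+1)) = q ^+ (2 * m) * q ^- (2 * k) by [].
  by rewrite mulnS exprD; field; rewrite expf_neq0.
rewrite -/(phi d) [in LHS]/d rmorph_contr enumE /=; apply: eq_bigr => k _.
have -> : phi (T 0%N k ord0) = dil_entries (q ^+ (2 * n)) k ord0.
  rewrite /phi /T /dil_entries [LHS]fps_dilM -paramM muln0 expr0 invr1 mulr1.
  by rewrite -exprD mulnS.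
have phi_alg c : phi c%:A = c%:A.
  by apply: fpsP => -[|r] /=; rewrite ?expr0 ?scale1r // !scaler0.
transitivity (dil_entries (q ^+ (2 * n)) k ord0 *
    (((- q) ^+ m * (- q) ^- (2 * k))%:A * C k)).
  congr (_ * _); rewrite -contr_mull => [|k' a b]; last by rewrite mulr_algl mulr_algr.
  apply: eq_contr => [k' i j|u su]; first exact: TS.
  by rewrite phi_alg (eps_rotate q_neq0) ?su // mulr_algl scalerA.
rewrite mulr_algl last_column_expansion qdet_comm_inv.
rewrite scalerA -scalerAr -scalerAl mulrA; congr (_ *: _).
have -> : (- q) ^+ (2 * k) = q ^+ (2 * k) by rewrite !exprM sqrrN.
by rewrite mulrAC mulfV ?mul1r // expf_neq0 // oppr_eq0.
Qed.

(** The entry (0, 0) of the hypothesis, multiplied by qdet L(u) on the right,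
    is the first column expansion of qdet L(q^2 u) up to the factor q^m. *)
Lemma qdet_ratio (z : fps A) :
  (map_mx (qshift q s (2 * n)) L)^T *m Dmat q *m (mxinv L)^T = z *: Dmat q ->
  z = qshift q s 2 (qdet q s L) / qdet q s L.
Proof.
have qshiftE k (x : fps A) : qshift q s k x = fps_dil (param s (q ^+ k)) x.
  by rewrite /qshift /param; case: s.
move=> /matrixP/(_ ord0 ord0) zE.
have zd : z * d = fps_dil (param s (q ^+ 2)) d.
  rewrite first_column_expansion.
  have q0 : q ^+ m != 0 by rewrite expf_neq0.
  apply: (scalerI q0); rewrite scaler_sumr.
  transitivity ((z *: Dmat q) (ord0 : 'I_n) (ord0 : 'I_n) * d).
    rewrite !mxE /= mulr1n /fps_scal fps_algE mulr_algr -scalerAl.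
    by congr (_ *: _); have -> : n%:Z - 1 - (2 * 0)%:Z = m by lia.
  apply: etrans (congr1 (fun x => x * d) (esym zE)) _.
  rewrite mxE mulr_suml; apply: eq_bigr => k _.
  rewrite mul_mx_diag !mxE -/N qshiftE /fps_scal fps_algE.
  rewrite mulr_algr -!scalerAl scalerA; congr (_ *: _).
  have -> : q ^ (n%:Z - 1 - (2 * k)%:Z) = q ^+ m * q ^- (2 * k).
    have -> : n%:Z - 1 - (2 * k)%:Z = m%:Z - (2 * k)%:Z by lia.
    by rewrite expfzDr // exprnN.
  by [].
rewrite qdet_contr qshiftE -zd mulrK // -qdet_contr.
exact: invertible_unit.
Qed.

End QdetRatio.

(** * The quantum affine algebra *)

Section QdetInvertible.
Variables (K : fieldType) (q : K) (m : nat) (A : algType K) (s : sgn).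
Local Notation n := m.+1.
Hypothesis q_neq0 : q != 0.
Variables (L : 'M[fps A]_n) (rho : 'I_n -> nat).
Hypothesis rho_inj : injective rho.
Hypothesis L0 : forall i j, (rho j < rho i)%N -> L i j 0%N = 0.
Hypothesis Ld : forall i, invertible (L i i 0%N).

(** Otherwise rho (p i) <= rho i for all i; both sides have the same sum over
    i, so p preserves rho. *)
Lemma perm_ascent (p : 'S_n) : p != 1%g -> exists i, (rho i < rho (p i))%N.
Proof.
move=> p1; apply/existsP; apply: contraNT p1; rewrite negb_exists => /forallP p_le.
have le i : (rho (p i) <= rho i ?= iff (rho (p i) == rho i))%N.
  by apply/leqifP; have := p_le i; rewrite -leqNgt leq_eqVlt; case: eqP.
have [_] := leqif_sum (fun i (_ : true) => le i).
rewrite [X in X == _](_ : _ = (\sum_i rho i)%N); last first.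
  by rewrite [RHS](reindex_inj (@perm_inj _ p)).
rewrite eqxx => /esym/forallP pE; apply/eqP/permP => i; rewrite perm1.
by apply: rho_inj; apply/eqP; apply: pE.
Qed.

(** The constant term of L(u) is triangular, so only the identity permutation
    contributes to the constant term of the quantum determinant. *)
Lemma qdet_invertible : invertible (qdet q s L).
Proof.
have sum1 (F : 'S_n -> A) : (forall p, p != 1%g -> F p = 0) -> \sum_p F p = F 1%g.
  by move=> F0; rewrite (bigD1 (1%g : 'S_n)) //= [X in _ + X]big1 ?addr0.
apply: fps_invertible; rewrite /qdet fps_coef_sum sum1 => [|p p1]; last first.
  have [i ip] := perm_ascent p1; rewrite fps_coef0M fps_coef0_prod.
  by rewrite (prod_eq0_seq (i := i)) ?mulr0 ?mem_index_enum //= L0 ?scaler0.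
rewrite fps_coef0M fps_coef0_prod; apply: invertibleM.
  exists ((- q) ^+ perm_length (1%g : 'S_n))%:A.
  by rewrite /= !mulr_algl !scalerA mulVf ?mulfV ?scale1r ?expf_neq0 ?oppr_eq0.
elim/big_ind: _ => [||i _]; [exact: invertible1 | exact: invertibleM |].
by rewrite perm1 /= expr0 scale1r.
Qed.

Lemma fps_mx_invertible : (forall i, (rho i < n)%N) -> invertible L.
Proof.
move=> rho_n; apply: invertible_mx_fps; apply: (invertible_triangular rho_n rho_inj).
  by move=> i j ij; rewrite mxE L0.
by move=> i; rewrite mxE.
Qed.

End QdetInvertible.

Section QuantumAffineRelations.
Variables (K : fieldType) (m : nat) (q : K) (f : fps K).
Local Notation n := m.+1.
Local Notation pi := (quot_pi (tsideal_gen (@uq_ideal_proper K n q f))).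

Lemma Lser_exchange s x c : q != 0 -> f 0%N = 1 -> x != 0 ->
  exchange q x (dil_entries s (Lser s : 'M[fps (Uq n q f)]_n) (x * c))
    (dil_entries s (Lser s : 'M[fps (Uq n q f)]_n) c).
Proof.
move=> q_neq0 f0 x0; pose L r : 'M[Uq n q f]_n := \matrix_(i, j) Lser s i j r.
have LE a : coef_int s L a = Lint n q f s a.
  apply/matrixP => i j; rewrite /coef_int /Lint.
  by case: s @L => L; case: a => [[|r]|r]; rewrite /L !mxE ?rmorph0.
have RLL a b : Rcomm (Rmat n q) (coef_int s L a) (coef_int s L b) =
    Rcomm (Rtmat n q) (coef_int s L (a - 1)) (coef_int s L (b + 1)).
  rewrite !LE; apply: (Rcomm_cancel q_neq0 f0 (L := Lint n q f s)).
    exact: Lint_RLL.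
  exact: Lint_small.
have LserE y i j : fps_dil y (Fps (fun r => L r i j)) = fps_dil y (Lser s i j).
  by congr fps_dil; apply: fpsP => r /=; rewrite mxE.
by move=> i j k l; have := exchange_of_Rcomm RLL c x0 i j k l; rewrite !LserE.
Qed.

(** The constant terms of L^+(u) and L^-(u) are upper and lower triangular;
    this order of the indices makes both of them upper triangular. *)
Definition tri_height (s : sgn) (i : 'I_n) : nat :=
  if s is Plus then i else rev_ord i.

Lemma tri_height_inj s : injective (tri_height s).
Proof. by case: s => i j /ord_inj // /rev_ord_inj. Qed.

Lemma tri_height_ltn s i : (tri_height s i < n)%N.
Proof. by case: s; apply: ltn_ord. Qed.

Lemma Lser_tri s (i j : 'I_n) : (tri_height s j < tri_height s i)%N ->
  (Lser s : 'M[fps (Uq n q f)]_n) i j 0%N = 0.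
Proof.
move=> ji; rewrite mxE /=; apply: uq_relator0; case: s ji => /= ji.
  exact: RelTriPlus.
by apply: RelTriMinus; have := ltn_ord i; have := ltn_ord j; lia.
Qed.

Lemma Lser_diag s (i : 'I_n) : invertible ((Lser s : 'M[fps (Uq n q f)]_n) i i 0%N).
Proof.
have rel x y : uq_relator q f (x * y - 1) -> (pi x : Uq n q f) * pi y = 1.
  by move=> /uq_relator0/eqP; rewrite rmorphB rmorphM rmorph1 subr_eq0 => /eqP.
have PM := rel _ _ (RelDiagPM q f i); have MP := rel _ _ (RelDiagMP q f i).
case: s; rewrite mxE /=.
  exact: (ex_intro _ (pi (fvar K (GenL Minus i i 0))) (conj MP PM)).
exact: (ex_intro _ (pi (fvar K (GenL Plus i i 0))) (conj PM MP)).
Qed.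

End QuantumAffineRelations.

Theorem theorem2p4 (R : realType) (n : nat) (q : R[i]) (f : fps R[i])
    (n_gt0 : (0 < n)%N) (q_neq0 : q != 0)
    (q_nroot : forall m : nat, (0 < m)%N -> q ^+ m != 1)
    (f_factor : is_Rfactor n q f)
    (s : sgn) (z : fps (Uq n q f))
    (z_def : (map_mx (qshift q s (2 * n)) (Lser s))^T *m Dmat q
               *m (mxinv (Lser s))^T = z *: Dmat q) :
  z = qshift q s 2 (qdet q s (Lser s)) / qdet q s (Lser s).
Proof.
case: n n_gt0 f_factor z z_def => // m _ [f0 _] z.
have tri := @Lser_tri _ m q f s; have diag := @Lser_diag _ m q f s.
have ex x c (x0 : x != 0) := @Lser_exchange _ m q f s x c q_neq0 f0 x0.
have L_inv := fps_mx_invertible (@tri_height_inj m s) tri diag (@tri_height_ltn m s).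
have d_inv := qdet_invertible s q_neq0 (@tri_height_inj m s) tri diag.
exact: (qdet_ratio q_neq0 q_nroot ex L_inv d_inv).
Qed.
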